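(* Let $(X,d)$ be a compact metric space and let $\phi$ be a continuous flow on $X$. If there exists a point $x\in\Omega(\phi)\setminus Crit(\phi)$ which is strongly-shadowable and uniformly-expansive, then there exists a closed $\phi$-invariant set $Y\subset X$ such that $\phi|_Y$ is conjugate to a suspension flow of a subshift with positive entropy.
   Context: A continuous flow on $X$ is a continuous map $\phi:\mathbb{R}\times X\to X$, $\phi^t(x)=\phi(t,x)$, with $\phi^0=\mathrm{id}$ and $\phi^{t+s}=\phi^s\circ\phi^t$; $O(x)=\{\phi^t(x):t\in\mathbb{R}\}$. A point $x$ is periodic if there is $T>0$ with $\phi^{t+T}(x)=\phi^t(x)$ for all $t$; its period $\pi(x)$ is the infimum of such $T\ge0$, and $x$ is a singularity if $\pi(x)=0$. $Sing(\phi)$ and $Per(\phi)$ denote the sets of singularities and periodic points, and $Crit(\phi)=Sing(\phi)\cup Per(\phi)$. $x$ is wandering if there are a neighborhood $U$ of $x$ and $T>0$ with $\phi^t(x)\notin U$ for all $t\ge T$; $\Omega(\phi)$ is the set of non-wandering points. A reparametrization is an increasing homeomorphism $h:\mathbb{R}\to\mathbb{R}$ with $h(0)=0$; $Rep_\varepsilon(\phi)$ is the set of those with $\left|\frac{h(x)-h(y)}{x-y}-1\right|\le\varepsilon$ for all $x\ne y$. A sequence $(x_i,t_i)_{i=a}^b$ is a $(\delta,T)$-pseudo-orbit if $t_i\ge T$ and $d(\phi^{t_i}(x_i),x_{i+1})<\delta$ for all $i$. Put $s_i=\sum_{n=0}^{i-1}t_n$ for $i\ge0$, $s_i=-\sum_{n=i}^{-1}t_n$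 for $i<0$. It is $\varepsilon$-strongly-shadowed if there are $y\in X$ and $h\in Rep_\varepsilon(\phi)$ with $d(\phi^{h(t)}(y),\phi^{t-s_i}(x_i))<\varepsilon$ for all $i$ and $s_i\le t\le s_{i+1}$. A point $x$ is strongly-shadowable if for every $\varepsilon>0$ there is $\delta>0$ such that every $(\delta,1)$-pseudo-orbit $(x_i,t_i)$ with $x_0=x$ is $\varepsilon$-strongly-shadowed. A point $x$ is uniformly-expansive if there is a neighborhood $U$ of $x$ such that for every $\varepsilon>0$ there is $\delta>0$ such that whenever $y,z\in U$ and some reparametrization $h$ satisfies $d(\phi^t(y),\phi^{h(t)}(z))<\delta$ for all $t\in\mathbb{R}$, then $y=\phi^t(w)$ with $w\in O(z)$ and $|t|<\varepsilon$. A subshift is a closed shift-invariant subset of $\mathcal{A}^{\mathbb{Z}}$ ($\mathcal{A}$ finite) with the shift map. Given a homeomorphism $f$ of a compact metric space $Z$ and continuous $r:Z\to(0,\infty)$, the suspension flow with roof $r$ is the flow on $\{(z,t):0\le t\le r(z)\}/(z,r(z))\sim(f(z),0)$ induced by translation in the second coordinate. Conjugate means there is a homeomorphism intertwining the flows. *)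

(* Defs.v *)
From Stdlib Require Import Reals ZArith List Relations.
From Coquelicot Require Import Coquelicot.
Open Scope R_scope.

Definition is_metric {X : Type} (d : X -> X -> R) : Prop :=
  (forall x y, 0 <= d x y) /\
  (forall x y, d x y = 0 <-> x = y) /\
  (forall x y, d x y = d y x) /\
  (forall x y z, d x z <= d x y + d y z).

Definition seq_conv {X : Type} (d : X -> X -> R) (u : nat -> X) (l : X) : Prop :=
  forall eps, 0 < eps -> exists N, forall n, (N <= n)%nat -> d (u n) l < eps.

Definition compact_metric {X : Type} (d : X -> X -> R) : Prop :=
  forall u : nat -> X, exists (g : nat -> nat) (l : X),
    (forall n m, (n < m)%nat -> (g n < g m)%nat) /\ seq_conv d (fun n => u (g n)) l.

Definition nbhd {X : Type} (d : X -> X -> R) (x : X) (U : X -> Prop) : Prop :=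
  exists r, 0 < r /\ forall y, d x y < r -> U y.

Definition closed_in {X : Type} (d : X -> X -> R) (Y : X -> Prop) : Prop :=
  forall (u : nat -> X) l, (forall n, Y (u n)) -> seq_conv d u l -> Y l.

Definition is_flow {X : Type} (d : X -> X -> R) (phi : R -> X -> X) : Prop :=
  (forall t x eps, 0 < eps -> exists del, 0 < del /\
      forall s y, Rabs (s - t) < del -> d x y < del -> d (phi s y) (phi t x) < eps) /\
  (forall x, phi 0 x = x) /\
  (forall t s x, phi (t + s) x = phi s (phi t x)).

Definition orbit {X : Type} (phi : R -> X -> X) (x : X) : X -> Prop :=
  fun y => exists t, y = phi t x.

Definition is_period_of {X : Type} (phi : R -> X -> X) (x : X) (T : R) : Prop :=
  forall t, phi (t + T) x = phi t x.

Definition periodic {X : Type} (phi : R -> X -> X) (x : X) : Prop :=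
  exists T, 0 < T /\ is_period_of phi x T.

Definition is_period {X : Type} (phi : R -> X -> X) (x : X) (p : R) : Prop :=
  (forall T, 0 < T -> is_period_of phi x T -> p <= T) /\
  (forall q, (forall T, 0 < T -> is_period_of phi x T -> q <= T) -> q <= p).

Definition Sing {X : Type} (phi : R -> X -> X) (x : X) : Prop :=
  periodic phi x /\ is_period phi x 0.

Definition Per {X : Type} (phi : R -> X -> X) (x : X) : Prop := periodic phi x.

Definition Crit {X : Type} (phi : R -> X -> X) (x : X) : Prop :=
  Sing phi x \/ Per phi x.

Definition wandering {X : Type} (d : X -> X -> R) (phi : R -> X -> X) (x : X) : Prop :=
  exists U, nbhd d x U /\ exists T, 0 < T /\ forall t, T <= t -> ~ U (phi t x).

Definition nonwandering {X : Type} (d : X -> X -> R) (phi : R -> X -> X) (x : X) : Prop :=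
  ~ wandering d phi x.

Definition reparam (h : R -> R) : Prop :=
  (forall a b, a < b -> h a < h b) /\
  (forall a, continuity_pt h a) /\
  (forall c, exists a, h a = c) /\
  h 0 = 0.

Definition Rep (eps : R) (h : R -> R) : Prop :=
  reparam h /\ forall a b, a <> b -> Rabs ((h a - h b) / (a - b) - 1) <= eps.

(* index range [a,b] with a in Z u {-oo} (None) and b in Z u {+oo} (None) *)
Definition in_range (a b : option Z) (i : Z) : Prop :=
  (match a with None => True | Some a => (a <= i)%Z end) /\
  (match b with None => True | Some b => (i <= b)%Z end).

Definition pseudo_orbit {X : Type} (d : X -> X -> R) (phi : R -> X -> X)
  (del T : R) (a b : option Z) (xs : Z -> X) (ts : Z -> R) : Prop :=
  (forall i, in_range a b i -> T <= ts i) /\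
  (forall i, in_range a b i -> in_range a b (i + 1)%Z ->
     d (phi (ts i) (xs i)) (xs (i + 1)%Z) < del).

Fixpoint spos (ts : Z -> R) (k : nat) : R :=
  match k with O => 0 | S k => spos ts k + ts (Z.of_nat k) end.
Fixpoint sneg (ts : Z -> R) (k : nat) : R :=
  match k with O => 0 | S k => sneg ts k - ts (- Z.of_nat (S k))%Z end.

(* s_i = sum_{n=0}^{i-1} t_n for i >= 0,  s_i = - sum_{n=i}^{-1} t_n for i < 0 *)
Definition sseq (ts : Z -> R) (i : Z) : R :=
  if (0 <=? i)%Z then spos ts (Z.to_nat i) else sneg ts (Z.to_nat (- i)).

Definition strongly_shadowed {X : Type} (d : X -> X -> R) (phi : R -> X -> X)
  (eps : R) (a b : option Z) (xs : Z -> X) (ts : Z -> R) : Prop :=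
  exists (y : X) (h : R -> R), Rep eps h /\
    forall i, in_range a b i -> forall t, sseq ts i <= t <= sseq ts (i + 1)%Z ->
      d (phi (h t) y) (phi (t - sseq ts i) (xs i)) < eps.

Definition strongly_shadowable {X : Type} (d : X -> X -> R) (phi : R -> X -> X)
  (x : X) : Prop :=
  forall eps, 0 < eps -> exists del, 0 < del /\
    forall a b xs ts, in_range a b 0 -> pseudo_orbit d phi del 1 a b xs ts ->
      xs 0%Z = x -> strongly_shadowed d phi eps a b xs ts.

Definition uniformly_expansive {X : Type} (d : X -> X -> R) (phi : R -> X -> X)
  (x : X) : Prop :=
  exists U, nbhd d x U /\ forall eps, 0 < eps -> exists del, 0 < del /\
    forall y z, U y -> U z -> forall h, reparam h ->
      (forall t, d (phi t y) (phi (h t) z) < del) ->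
      exists t w, orbit phi z w /\ Rabs t < eps /\ y = phi t w.

Definition agree_on (N : nat) (x y : Z -> nat) : Prop :=
  forall i, (- Z.of_nat N <= i <= Z.of_nat N)%Z -> x i = y i.

Definition shift (x : Z -> nat) : Z -> nat := fun i => x (i + 1)%Z.

Definition subshift (k : nat) (Sig : (Z -> nat) -> Prop) : Prop :=
  (forall x, Sig x -> forall i, (x i < k)%nat) /\
  (forall x, (forall i, (x i < k)%nat) ->
     (forall N, exists y, Sig y /\ agree_on N x y) -> Sig x) /\
  (forall x, Sig x <-> Sig (shift x)).

Definition word_of (Sig : (Z -> nat) -> Prop) (n : nat) (w : list nat) : Prop :=
  length w = n /\ exists y i, Sig y /\
    forall j, (j < n)%nat -> nth j w 0%nat = y (i + Z.of_nat j)%Z.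

Definition has_card {A : Type} (P : A -> Prop) (c : nat) : Prop :=
  exists l, NoDup l /\ (forall a, In a l <-> P a) /\ length l = c.

Definition positive_entropy (Sig : (Z -> nat) -> Prop) : Prop :=
  exists c : nat -> nat, (forall n, has_card (word_of Sig n) (c n)) /\
    Rbar_lt (Finite 0) (Lim_seq (fun n => ln (INR (c (S n))) / INR (S n))).

Definition susp_step (Sig : (Z -> nat) -> Prop) (r : (Z -> nat) -> R)
  (p q : (Z -> nat) * R) : Prop :=
  Sig (fst p) /\ q = (shift (fst p), snd p - r (fst p)).

(* phi restricted to Y is conjugate to the suspension flow of the shift on
   Sig with roof r: H : Sig x R -> Y is continuous, onto Y, intertwines
   the translation flow with phi, and its fibres are exactly the
   equivalence classes of the suspension identification.  (The induced
   map from the compact quotient Sig x R/~ onto Y is then a homeomorphism.) *)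
Definition conj_suspension {X : Type} (d : X -> X -> R) (phi : R -> X -> X)
  (Y : X -> Prop) (Sig : (Z -> nat) -> Prop) (r : (Z -> nat) -> R)
  (H : (Z -> nat) -> R -> X) : Prop :=
  (forall z t, Sig z -> Y (H z t)) /\
  (forall y, Y y -> exists z t, Sig z /\ H z t = y) /\
  (forall z t eps, Sig z -> 0 < eps -> exists N del, 0 < del /\
      forall z' t', Sig z' -> agree_on N z z' -> Rabs (t' - t) < del ->
        d (H z t) (H z' t') < eps) /\
  (forall z t s, Sig z -> H z (t + s) = phi s (H z t)) /\
  (forall z t z' t', Sig z -> Sig z' ->
     (H z t = H z' t' <-> clos_refl_sym_trans _ (susp_step Sig r) (z, t) (z', t'))).

Definition roof (Sig : (Z -> nat) -> Prop) (r : (Z -> nat) -> R) : Prop :=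
  (forall z, Sig z -> 0 < r z) /\
  (forall z eps, Sig z -> 0 < eps -> exists N,
     forall z', Sig z' -> agree_on N z z' -> Rabs (r z' - r z) < eps).

(* Main.v *)
(* In this setting a non-wandering point x is forward recurrent, so sequences of
   return times of x give pseudo-orbits through x.  Repeating one return time TA
   for ever is shadowed by points of a single orbit, which is therefore closed;
   by Baire it misses x.  Shadowing at a scale finer than the distance from x to
   this orbit gives a second return time TB whose repetition is not shadowed by
   the closed orbit, hence neither is a long enough block of TB's inserted
   between two infinite runs of TA.

   A word w in four letters is coded by blocks of TB's ("marks") separated by
   long runs of TA's, the letters giving the distances between marks.  A tracking
   point is close to the closed orbit except during one excursion of bounded
   length at each mark, so its orbit determines w up to a shift, and, when w is
   aperiodic, the tracking point itself up to a bounded time.  The centre of mass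
   in time of the excursion at mark 0 then selects one point of each orbit
   continuously.  The weak expansivity (which only puts points on a common orbit)
   could fail to fix the phase over periodic words; this is avoided by taking
   for the subshift a Sturmian condition on one bit, the other bit being free. *)

From Stdlib Require Import Reals ZArith List Relations Lra Lia Cantor FinFun.
From Stdlib Require Import Classical ClassicalEpsilon FunctionalExtensionality.
From Coquelicot Require Import Coquelicot.
Require Import Defs.
Open Scope R_scope.

(** Expansivity tells when two points tracking one sequence share an orbit; it does not separate the
    orbits coming from different sequences. The word must be read off the dynamics, and the
    observable is the distance to the closed orbit. Absolute times cannot be read, since a
    reparametrization with slopes in [9/10, 11/10] may drift without bound; the gap between
    consecutive marks, however, is distorted only by a factor in that interval. Gaps near L, 2L, 3L,
    4L remain distinguishable because 11/10 * 3 < 9/10 * 4, up to errors small against L; four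
    letters provide the two bits needed.

    The uniform constants come from one compactness principle: tracking is a closed relation between
    a sequence of times and a point, since bilipschitz maps have pointwise convergent subsequences.
    A fact about one limiting sequence (constant, or a single block) thus holds, by contradiction,
    for all sequences agreeing with it on a long enough window. The constants are fixed in the order
    e, TA, TB, m, then N and rho, then [width], then M. *)

Lemma Rabs_le_inv a b : Rabs a <= b -> - b <= a <= b.
Proof. unfold Rabs; destruct (Rcase_abs a); lra. Qed.

(** * Integer-indexed partial sums *)

Lemma sseq_0 ts : sseq ts 0%Z = 0.
Proof. reflexivity. Qed.

Lemma sseq_succ ts i : sseq ts (i + 1)%Z = sseq ts i + ts i.
Proof.
unfold sseq.
destruct (Z.leb_spec 0 i) as [Hi|Hi].
- destruct (Z.leb_spec 0 (i + 1)); [|lia].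
  replace (Z.to_nat (i + 1)) with (S (Z.to_nat i)) by lia; simpl.
  now rewrite Z2Nat.id by lia.
- destruct (Z.eq_dec i (-1)) as [->|Hn]; [simpl; lra|].
  destruct (Z.leb_spec 0 (i + 1)); [lia|].
  replace (Z.to_nat (- i)) with (S (Z.to_nat (- (i + 1)))) by lia.
  cbn [sneg].
  replace (- Z.of_nat (S (Z.to_nat (- (i + 1)))))%Z with i by lia; lra.
Qed.

Lemma sseq_unique ts (a : Z -> R) :
  a 0%Z = 0 -> (forall i, a (i + 1)%Z = a i + ts i) -> forall i, a i = sseq ts i.
Proof.
intros H0 Hs; apply Z.peano_ind.
- now rewrite sseq_0.
- intros i Hi; rewrite <- Z.add_1_r, Hs, sseq_succ, Hi; reflexivity.
- intros i Hi.
  pose proof (Hs (Z.pred i)) as H1; pose proof (sseq_succ ts (Z.pred i)) as H2.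
  replace (Z.pred i + 1)%Z with i in H1, H2 by lia; lra.
Qed.

Lemma sseq_shift ts j i :
  sseq (fun n => ts (n + j)%Z) i = sseq ts (i + j)%Z - sseq ts j.
Proof.
symmetry; apply (sseq_unique _ (fun i => sseq ts (i + j)%Z - sseq ts j)).
- rewrite Z.add_0_l; lra.
- intros k; replace (k + 1 + j)%Z with (k + j + 1)%Z by lia.
  rewrite sseq_succ; lra.
Qed.

Lemma sseq_eventually (tsn : nat -> Z -> R) ts :
  (forall i, exists n0, forall n, (n0 <= n)%nat -> tsn n i = ts i) ->
  forall i, exists n0, forall n, (n0 <= n)%nat -> sseq (tsn n) i = sseq ts i.
Proof.
intros H; apply Z.peano_ind.
- exists 0%nat; intros; now rewrite !sseq_0.
- intros i [n0 H0]; destruct (H i) as [n1 H1]; exists (n0 + n1)%nat.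
  intros n Hn; rewrite <- Z.add_1_r, !sseq_succ, H0, H1 by lia; reflexivity.
- intros i [n0 H0]; destruct (H (Z.pred i)) as [n1 H1]; exists (n0 + n1)%nat.
  intros n Hn; specialize (H0 n ltac:(lia)); specialize (H1 n ltac:(lia)).
  replace i with (Z.pred i + 1)%Z in H0 by lia; rewrite !sseq_succ in H0; lra.
Qed.

Lemma steps_lower (a : Z -> R) g :
  (forall i, g <= a (i + 1)%Z - a i) ->
  forall i j, (i <= j)%Z -> IZR (j - i) * g <= a j - a i.
Proof.
intros H i j Hij.
replace j with (i + Z.of_nat (Z.to_nat (j - i)))%Z by lia.
generalize (Z.to_nat (j - i)); intros n.
induction n as [|n IH].
- replace (i + Z.of_nat 0 - i)%Z with 0%Z by lia.
  replace (i + Z.of_nat 0)%Z with i by lia; lra.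
- specialize (H (i + Z.of_nat n)%Z).
  replace (i + Z.of_nat n + 1)%Z with (i + Z.of_nat (S n))%Z in H by lia.
  replace (i + Z.of_nat (S n) - i)%Z with (i + Z.of_nat n - i + 1)%Z by lia.
  rewrite plus_IZR; lra.
Qed.

Lemma steps_upper (a : Z -> R) g :
  (forall i, a (i + 1)%Z - a i <= g) ->
  forall i j, (i <= j)%Z -> a j - a i <= IZR (j - i) * g.
Proof.
intros H i j Hij.
assert (IZR (j - i) * - g <= - a j - - a i); [|lra].
apply (steps_lower (fun i => - a i)); [|exact Hij].
intros k; specialize (H k); lra.
Qed.

Lemma steps_locate (a : Z -> R) g :
  0 < g -> (forall i, g <= a (i + 1)%Z - a i) ->
  forall t, exists i, a i <= t < a (i + 1)%Z.
Proof.
intros Hg H t.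
assert (Hn : forall n i, a i <= t -> t < a (i + Z.of_nat n)%Z ->
  exists i, a i <= t < a (i + 1)%Z).
{ induction n as [|n IH]; intros i H1 H2.
  - rewrite Z.add_0_r in H2; lra.
  - destruct (Rlt_le_dec t (a (i + 1)%Z)) as [H3|H3]; [now exists i|].
    apply (IH (i + 1)%Z H3).
    now replace (i + 1 + Z.of_nat n)%Z with (i + Z.of_nat (S n))%Z by lia. }
(* With K above |t - a 0| / g, the value t lies between a (-K) and a K, so walking up 2K steps from
   -K must pass it. *)
set (K := Z.abs (up (Rabs (t - a 0%Z) / g))).
assert (HK : Rabs (t - a 0%Z) < IZR K * g).
{ apply (Rmult_lt_reg_r (/ g)); [now apply Rinv_0_lt_compat|].
  rewrite Rmult_assoc, Rinv_r by lra; rewrite Rmult_1_r.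
  apply Rlt_le_trans with (IZR (up (Rabs (t - a 0%Z) / g))).
  - apply archimed.
  - unfold K; apply IZR_le; lia. }
assert (HK0 : (0 <= K)%Z) by (unfold K; lia).
pose proof (steps_lower a g H (- K) 0 ltac:(lia)) as H1.
pose proof (steps_lower a g H 0 K ltac:(lia)) as H2.
replace (0 - - K)%Z with K in H1 by lia; replace (K - 0)%Z with K in H2 by lia.
pose proof (Rle_abs (t - a 0%Z)); pose proof (Rle_abs (- (t - a 0%Z))) as H4.
rewrite Rabs_Ropp in H4.
apply (Hn (Z.to_nat (2 * K)) (- K)%Z); [lra|].
replace (- K + Z.of_nat (Z.to_nat (2 * K)))%Z with K by lia; lra.
Qed.

(** * Subsequences *)

Definition incr (g : nat -> nat) := forall n m, (n < m)%nat -> (g n < g m)%nat.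

Lemma incr_ge g : incr g -> forall n, (n <= g n)%nat.
Proof.
intros H; induction n as [|n IH]; [lia|].
specialize (H n (S n) ltac:(lia)); lia.
Qed.

Lemma incr_comp g h : incr g -> incr h -> incr (fun n => g (h n)).
Proof. intros Hg Hh n m Hnm; apply Hg, Hh, Hnm. Qed.

Definition rconv (u : nat -> R) (l : R) :=
  forall eps, 0 < eps -> exists N, forall n, (N <= n)%nat -> Rabs (u n - l) < eps.

Lemma rconv_sub u l g : rconv u l -> incr g -> rconv (fun n => u (g n)) l.
Proof.
intros Hu Hg eps He; destruct (Hu eps He) as [N HN]; exists N; intros n Hn.
apply HN; pose proof (incr_ge g Hg n); lia.
Qed.

Lemma incr_extract (P : nat -> nat -> Prop) :
  (forall k N, exists p, (N <= p)%nat /\ P k p) ->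
  exists g, incr g /\ forall n, P n (g n).
Proof.
intros H.
destruct (choice (fun (q : nat * nat) p => (snd q <= p)%nat /\ P (fst q) p)) as [e He].
{ intros [k N]; apply H. }
set (g := fix g n := match n with O => e (0%nat, 0%nat) | S n => e (S n, S (g n)) end).
exists g; split.
- assert (Hs : forall n, (g n < g (S n))%nat).
  { intros n; destruct (He (S n, S (g n))) as [H1 _]; exact H1. }
  intros n m Hnm; induction Hnm as [|m Hnm IH]; [apply Hs|].
  specialize (Hs m); lia.
- intros [|n]; [apply (He (0%nat, 0%nat))|apply (He (S n, S (g n)))].
Qed.

Lemma bounded_subsequence (u : nat -> R) B :
  (forall n, Rabs (u n) <= B) -> exists g l, incr g /\ rconv (fun n => u (g n)) l.
Proof.
intros H.
destruct (Bolzano_Weierstrass u (fun c => - B <= c <= B)) as [l Hl].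
{ apply compact_P3. }
{ intros n; specialize (H n); unfold Rabs in H; destruct (Rcase_abs (u n)); lra. }
destruct (incr_extract (fun k p => Rabs (u p - l) < / INR (S k))) as [g [Hg1 Hg2]].
{ intros k N.
  assert (Hk : 0 < / INR (S k)) by (apply Rinv_0_lt_compat, lt_0_INR; lia).
  destruct (Hl (disc l (mkposreal _ Hk)) N) as [p [Hp1 Hp2]].
  - now exists (mkposreal _ Hk).
  - exists p; split; [exact Hp1|exact Hp2]. }
exists g, l; split; [exact Hg1|].
intros eps He; destruct (archimed_cor1 eps He) as [N [HN HN0]].
exists N; intros n Hn; eapply Rlt_trans; [apply Hg2|].
eapply Rle_lt_trans; [|exact HN].
apply Rinv_le_contravar; [apply lt_0_INR; lia|apply le_INR; lia].
Qed.

(** [G k] refines its predecessors so that coordinate k converges; from index k on, the diagonal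
    [G n n] is a subsequence of [G k]. *)
Lemma diagonal_subsequence (f : nat -> nat -> R) (B : nat -> R) :
  (forall n k, Rabs (f n k) <= B k) ->
  exists g, incr g /\ forall k, exists l, rconv (fun n => f (g n) k) l.
Proof.
intros HB.
destruct (choice (fun (q : nat * (nat -> nat)) e =>
  incr e /\ exists l, rconv (fun n => f (snd q (e n)) (fst q)) l)) as [e He].
{ intros [k g]; destruct (bounded_subsequence (fun n => f (g n) k) (B k)) as [h [l [H1 H2]]].
  - intros n; apply HB.
  - exists h; split; [exact H1|now exists l]. }
set (G := fix G k := match k with
  | O => e (0%nat, fun n => n)
  | S k => fun n => G k (e (S k, G k) n) end).
assert (HG : forall k, incr (G k)).
{ induction k as [|k IH]; [apply He|].
  apply (incr_comp (G k)); [exact IH|apply He]. }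
assert (HGc : forall k, exists l, rconv (fun n => f (G k n) k) l).
{ intros [|k]; [apply (He (0%nat, fun n => n))|apply (He (S k, G k))]. }
assert (Hsub : forall k j, exists h, incr h /\ forall n, G (j + k)%nat n = G k (h n)).
{ intros k; induction j as [|j [h [Hh1 Hh2]]].
  - exists (fun n => n); split; [intros n m; tauto|reflexivity].
  - exists (fun n => h (e (S (j + k), G (j + k)%nat) n)); split.
    + apply (incr_comp h); [exact Hh1|apply He].
    + intros n; simpl; now rewrite Hh2. }
exists (fun n => G n n); split.
- assert (Hs : forall n, (G n n < G (S n) (S n))%nat).
  { intros n; simpl; apply HG.
    pose proof (incr_ge _ (proj1 (He (S n, G n))) (S n)); lia. }
  intros n m Hnm; induction Hnm as [|m Hnm IH]; [apply Hs|].
  specialize (Hs m); lia.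
- intros k; destruct (HGc k) as [l Hl]; exists l; intros eps Heps.
  destruct (Hl eps Heps) as [N HN]; exists (N + k)%nat; intros n Hn.
  destruct (Hsub k (n - k)%nat) as [h [Hh1 Hh2]].
  replace (n - k + k)%nat with n in Hh2 by lia; rewrite Hh2.
  apply HN; pose proof (incr_ge h Hh1 n); lia.
Qed.

(** An enumeration of the rationals: the signed numerator is a difference of two naturals, and [S b]
    keeps the denominator nonzero. *)
Definition dense_point (n : nat) : R :=
  let (a, b) := of_nat n in
  let (p, q) := of_nat a in (INR p - INR q) / INR (S b).

Lemma dense_point_dense t eps : 0 < eps -> exists k, Rabs (dense_point k - t) < eps.
Proof.
intros He; destruct (archimed_cor1 eps He) as [b [Hb Hb0]].
set (z := up (t * INR b)).
exists (to_nat (to_nat (Z.to_nat z, Z.to_nat (- z)), pred b)).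
unfold dense_point; rewrite !cancel_of_to.
replace (S (pred b)) with b by lia.
assert (Hz : INR (Z.to_nat z) - INR (Z.to_nat (- z)) = IZR z).
{ rewrite !INR_IZR_INZ, <- minus_IZR; f_equal; lia. }
rewrite Hz.
assert (Hbp : 0 < INR b) by (apply lt_0_INR; lia).
pose proof (archimed (t * INR b)) as [H1 H2]; fold z in H1, H2.
replace (IZR z / INR b - t) with ((IZR z - t * INR b) * / INR b) by (field; lra).
rewrite Rabs_mult, (Rabs_pos_eq (/ _)) by (left; now apply Rinv_0_lt_compat).
rewrite Rabs_pos_eq by lra.
eapply Rle_lt_trans; [|exact Hb].
rewrite <- (Rmult_1_l (/ INR b)) at 2.
apply Rmult_le_compat_r; [left; now apply Rinv_0_lt_compat|lra].
Qed.

(** * Bilipschitz reparametrizations *)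

(** What [Rep eps] gives for eps at most 1/10, in a form that survives pointwise limits; continuity
    and surjectivity follow from it. *)
Definition bilip (h : R -> R) :=
  h 0 = 0 /\ forall a b, a <= b -> 9/10 * (b - a) <= h b - h a <= 11/10 * (b - a).

Lemma Rep_bilip eps h : eps <= 1/10 -> Rep eps h -> bilip h.
Proof.
intros He [[_ [_ [_ H0]]] H]; split; [exact H0|].
intros a b Hab; destruct (Req_dec a b) as [->|Hn]; [lra|].
specialize (H b a ltac:(lra)).
set (q := (h b - h a) / (b - a)) in H.
assert (Hq : h b - h a = q * (b - a)) by (unfold q; field; lra).
rewrite Hq; apply Rabs_le_inv in H.
split; apply Rmult_le_compat_r; lra.
Qed.

Lemma bilip_mono h a b : bilip h -> a < b -> h a < h b.
Proof. intros [_ H] Hab; specialize (H a b ltac:(lra)); lra. Qed.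

Lemma bilip_mono_inv h a b : bilip h -> h a < h b -> a < b.
Proof.
intros [_ H] Hab; destruct (Rlt_le_dec a b) as [|Hba]; [assumption|].
specialize (H b a Hba); lra.
Qed.

Lemma bilip_lipschitz h a b : bilip h -> Rabs (h a - h b) <= 11/10 * Rabs (a - b).
Proof.
intros [_ H]; destruct (Rle_dec a b) as [Hab|Hab].
- specialize (H a b Hab); rewrite Rabs_minus_sym, (Rabs_minus_sym a b), !Rabs_pos_eq; lra.
- specialize (H b a ltac:(lra)); rewrite !Rabs_pos_eq; lra.
Qed.

Lemma lipschitz_continuity_pt (h : R -> R) L :
  0 < L -> (forall a b, Rabs (h a - h b) <= L * Rabs (a - b)) ->
  forall a, continuity_pt h a.
Proof.
intros HL H a eps He; exists (eps / L); split.
- now apply Rdiv_lt_0_compat.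
- intros b [_ Hb]; simpl in *; unfold R_dist in *.
  eapply Rle_lt_trans; [apply H|].
  apply (Rmult_lt_compat_l L) in Hb; [|exact HL].
  now replace (L * (eps / L)) with eps in Hb by (field; lra).
Qed.

Lemma bilip_surj h c : bilip h -> exists a, h a = c.
Proof.
intros Hh; set (K := 2 * Rabs c + 1).
assert (HK : 0 < K) by (unfold K; pose proof (Rabs_pos c); lra).
assert (HcK : Rabs c < 9/10 * K) by (unfold K; pose proof (Rabs_pos c); lra).
apply Rabs_def2 in HcK.
destruct (IVT (fun t => h t - c) (- K) K) as [a [_ Ha]].
- intros t; apply (lipschitz_continuity_pt _ (11/10)); [lra|].
  intros a b; replace (h a - c - (h b - c)) with (h a - h b) by ring.
  now apply bilip_lipschitz.
- lra.
- destruct Hh as [H0 H]; specialize (H (- K) 0 ltac:(lra)); lra.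
- destruct Hh as [H0 H]; specialize (H 0 K ltac:(lra)); lra.
- exists a; lra.
Qed.

Lemma bilip_shift h c : bilip h -> bilip (fun t => h (t + c) - h c).
Proof.
intros [_ H]; split.
- rewrite Rplus_0_l; ring.
- intros a b Hab; specialize (H (a + c) (b + c) ltac:(lra)); lra.
Qed.

(** Arzelà-Ascoli: diagonal extraction gives convergence at the rationals, and the common Lipschitz
    constant extends it to every real. *)
Lemma bilip_limit (hn : nat -> R -> R) :
  (forall n, bilip (hn n)) ->
  exists g h, incr g /\ bilip h /\ forall t, rconv (fun n => hn (g n) t) (h t).
Proof.
intros H.
destruct (diagonal_subsequence (fun n k => hn n (dense_point k))
  (fun k => 11/10 * Rabs (dense_point k))) as [g [Hg Hd]].
{ intros n k; pose proof (bilip_lipschitz (hn n) (dense_point k) 0 (H n)) as Hb.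
  rewrite (proj1 (H n)), !Rminus_0_r in Hb; exact Hb. }
assert (Hlim : forall t, exists l, rconv (fun n => hn (g n) t) l).
{ intros t; destruct (Rcomplete.R_complete (fun n => hn (g n) t)) as [l Hl].
  - intros eps He.
    (* Two Lipschitz errors of 11/10 * eps/5 and two convergence errors of eps/5 add up to less than
       eps. *)
    destruct (dense_point_dense t (eps / 5) ltac:(lra)) as [k Hk].
    destruct (Hd k) as [l Hl]; destruct (Hl (eps / 5) ltac:(lra)) as [N HN].
    exists N; intros n m Hn Hm; unfold R_dist.
    pose proof (HN n Hn) as H1; pose proof (HN m Hm) as H2.
    pose proof (bilip_lipschitz (hn (g n)) (dense_point k) t (H _)) as H3.
    pose proof (bilip_lipschitz (hn (g m)) (dense_point k) t (H _)) as H4.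
    apply Rabs_def2 in H1; apply Rabs_def2 in H2.
    apply Rabs_le_inv in H3; apply Rabs_le_inv in H4.
    apply Rabs_def1; lra.
  - now exists l. }
apply choice in Hlim; destruct Hlim as [h Hh].
exists g, h; split; [exact Hg|]; split; [|exact Hh].
split.
- apply cond_eq; intros eps He; destruct (Hh 0 eps He) as [N HN].
  specialize (HN N (le_n _)); rewrite (proj1 (H _)) in HN.
  now rewrite Rabs_minus_sym.
- intros a b Hab.
  assert (Hap : forall eps, 0 < eps ->
    9/10 * (b - a) - eps <= h b - h a <= 11/10 * (b - a) + eps).
  { intros eps He; destruct (Hh a (eps / 2) ltac:(lra)) as [N HN].
    destruct (Hh b (eps / 2) ltac:(lra)) as [M HM].
    specialize (HN (N + M)%nat ltac:(lia)); specialize (HM (N + M)%nat ltac:(lia)).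
    pose proof (proj2 (H (g (N + M)%nat)) a b Hab).
    apply Rabs_def2 in HN; apply Rabs_def2 in HM; lra. }
  split; apply le_epsilon; intros eps He; specialize (Hap eps He); lra.
Qed.

(** * Flows on compact metric spaces *)

Section Flow.

Context {X : Type} (d : X -> X -> R) (phi : R -> X -> X).
Hypothesis Hd : is_metric d.
Hypothesis Hc : compact_metric d.
Hypothesis Hf : is_flow d phi.

Lemma dist_pos u v : 0 <= d u v.
Proof. apply Hd. Qed.

Lemma dist_self u : d u u = 0.
Proof. now apply (proj1 (proj2 Hd)). Qed.

Lemma dist_sym u v : d u v = d v u.
Proof. apply (proj1 (proj2 (proj2 Hd))). Qed.

Lemma dist_tri u v w : d u w <= d u v + d v w.
Proof. apply (proj2 (proj2 (proj2 Hd))). Qed.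

Lemma flow_0 u : phi 0 u = u.
Proof. apply Hf. Qed.

Lemma flow_flow s t u : phi s (phi t u) = phi (t + s) u.
Proof. symmetry; apply Hf. Qed.

Lemma flow_cancel t u v : phi t u = v -> u = phi (- t) v.
Proof. intros <-; rewrite flow_flow, Rplus_opp_r; now rewrite flow_0. Qed.

Lemma conv_sub (u : nat -> X) l g :
  seq_conv d u l -> incr g -> seq_conv d (fun n => u (g n)) l.
Proof.
intros Hu Hg eps He; destruct (Hu eps He) as [N HN]; exists N; intros n Hn.
apply HN; pose proof (incr_ge g Hg n); lia.
Qed.

Lemma conv_const u : seq_conv d (fun _ => u) u.
Proof. intros eps He; exists 0%nat; intros; now rewrite dist_self. Qed.

Lemma flow_conv (t : nat -> R) t0 (u : nat -> X) u0 :
  rconv t t0 -> seq_conv d u u0 -> seq_conv d (fun n => phi (t n) (u n)) (phi t0 u0).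
Proof.
intros Ht Hu eps He.
destruct (proj1 Hf t0 u0 eps He) as [del [Hdel H]].
destruct (Ht del Hdel) as [N HN]; destruct (Hu del Hdel) as [M HM].
exists (N + M)%nat; intros n Hn; apply H; [apply HN; lia|].
rewrite dist_sym; apply HM; lia.
Qed.

Lemma conv_dist_le (u v : nat -> X) l m c N :
  seq_conv d u l -> seq_conv d v m ->
  (forall n, (N <= n)%nat -> d (u n) (v n) <= c) -> d l m <= c.
Proof.
intros Hu Hv H; apply le_epsilon; intros eps He.
destruct (Hu (eps / 2) ltac:(lra)) as [N1 H1].
destruct (Hv (eps / 2) ltac:(lra)) as [N2 H2].
set (n := (N + N1 + N2)%nat).
specialize (H n ltac:(lia)); specialize (H1 n ltac:(lia)); specialize (H2 n ltac:(lia)).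
pose proof (dist_tri l (u n) m); pose proof (dist_tri (u n) (v n) m).
rewrite (dist_sym l (u n)) in *; lra.
Qed.

Lemma conv_unique (u : nat -> X) l m : seq_conv d u l -> seq_conv d u m -> l = m.
Proof.
intros Hl Hm; apply (proj1 (proj2 Hd)); pose proof (dist_pos l m).
assert (d l m <= 0); [|lra].
apply (conv_dist_le u u l m 0 0 Hl Hm); intros; rewrite dist_self; lra.
Qed.

Lemma inv_S_pos n : 0 < / INR (S n).
Proof. apply Rinv_0_lt_compat, lt_0_INR; lia. Qed.

Lemma inv_S_small eps : 0 < eps -> exists N, forall n, (N <= n)%nat -> / INR (S n) < eps.
Proof.
intros He; destruct (archimed_cor1 eps He) as [N [HN HN0]].
exists N; intros n Hn; eapply Rle_lt_trans; [|exact HN].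
apply Rinv_le_contravar; [apply lt_0_INR; lia|apply le_INR; lia].
Qed.

(** Uniform continuity on the compact set [-W, W] x X: counterexamples for 1/(n+1) would accumulate
    at a point where continuity fails. *)
Lemma flow_equicontinuous W eps :
  0 < eps -> exists del, 0 < del /\
    forall t u v, Rabs t <= W -> d u v < del -> d (phi t u) (phi t v) < eps.
Proof.
intros He; apply NNPP; intros Hno.
assert (H : forall n, exists q : R * X * X, Rabs (fst (fst q)) <= W /\
  d (snd (fst q)) (snd q) < / INR (S n) /\
  eps <= d (phi (fst (fst q)) (snd (fst q))) (phi (fst (fst q)) (snd q))).
{ intros n; apply NNPP; intros Hq; apply Hno; exists (/ INR (S n)).
  split; [apply inv_S_pos|]; intros t u v Ht Huv.
  destruct (Rlt_le_dec (d (phi t u) (phi t v)) eps) as [|Hle]; [assumption|].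
  exfalso; apply Hq; now exists (t, u, v). }
apply choice in H; destruct H as [q Hq].
destruct (bounded_subsequence (fun n => fst (fst (q n))) W) as [g1 [t0 [Hg1 Ht]]].
{ intros n; apply Hq. }
destruct (Hc (fun n => snd (fst (q (g1 n))))) as [g2 [u0 [Hg2 Hu]]].
set (g := fun n => g1 (g2 n)).
assert (Hg : incr g) by exact (incr_comp g1 g2 Hg1 Hg2).
assert (Hv : seq_conv d (fun n => snd (q (g n))) u0).
{ intros a Ha; destruct (Hu (a / 2) ltac:(lra)) as [N HN].
  destruct (inv_S_small (a / 2) ltac:(lra)) as [M HM].
  exists (N + M)%nat; intros n Hn; specialize (HN n ltac:(lia)).
  pose proof (incr_ge g Hg n); specialize (HM (g n) ltac:(lia)).
  destruct (Hq (g n)) as [_ [H1 _]].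
  pose proof (dist_tri (snd (q (g n))) (snd (fst (q (g n)))) u0) as H2.
  rewrite (dist_sym (snd (q (g n))) (snd (fst (q (g n))))) in H2; unfold g in *; lra. }
assert (Ht' : rconv (fun n => fst (fst (q (g n)))) t0)
  by exact (rconv_sub (fun n => fst (fst (q (g1 n)))) t0 g2 Ht Hg2).
pose proof (flow_conv _ _ _ _ Ht' Hu) as H1.
pose proof (flow_conv _ _ _ _ Ht' Hv) as H2.
destruct (H1 (eps / 2) ltac:(lra)) as [N HN]; destruct (H2 (eps / 2) ltac:(lra)) as [M HM].
specialize (HN (N + M)%nat ltac:(lia)); specialize (HM (N + M)%nat ltac:(lia)).
destruct (Hq (g (N + M)%nat)) as [_ [_ H3]].
rewrite (dist_sym _ (phi t0 u0)) in HM; fold (g (N + M)%nat) in HN.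
pose proof (dist_tri (phi (fst (fst (q (g (N + M)%nat)))) (snd (fst (q (g (N + M)%nat)))))
  (phi t0 u0) (phi (fst (fst (q (g (N + M)%nat)))) (snd (q (g (N + M)%nat))))); lra.
Qed.

Lemma flow_small_time eps :
  0 < eps -> exists k, 0 < k /\ forall t u, Rabs t < k -> d (phi t u) u < eps.
Proof.
intros He; apply NNPP; intros Hno.
assert (H : forall n, exists q : R * X, Rabs (fst q) < / INR (S n) /\
  eps <= d (phi (fst q) (snd q)) (snd q)).
{ intros n; apply NNPP; intros Hq; apply Hno; exists (/ INR (S n)).
  split; [apply inv_S_pos|]; intros t u Ht.
  destruct (Rlt_le_dec (d (phi t u) u) eps) as [|Hle]; [assumption|].
  exfalso; apply Hq; now exists (t, u). }
apply choice in H; destruct H as [q Hq].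
destruct (Hc (fun n => snd (q n))) as [g [u0 [Hg Hu]]].
assert (Ht : rconv (fun n => fst (q (g n))) 0).
{ intros a Ha; destruct (inv_S_small a Ha) as [M HM]; exists M; intros n Hn.
  rewrite Rminus_0_r; eapply Rlt_trans; [apply Hq|].
  apply HM; pose proof (incr_ge g Hg n); lia. }
pose proof (flow_conv _ _ _ _ Ht Hu) as H1; rewrite flow_0 in H1.
destruct (H1 (eps / 2) ltac:(lra)) as [N HN]; destruct (Hu (eps / 2) ltac:(lra)) as [M HM].
specialize (HN (N + M)%nat ltac:(lia)); specialize (HM (N + M)%nat ltac:(lia)).
destruct (Hq (g (N + M)%nat)) as [_ H3].
rewrite (dist_sym _ u0) in HM.
pose proof (dist_tri (phi (fst (q (g (N + M)%nat))) (snd (q (g (N + M)%nat)))) u0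
  (snd (q (g (N + M)%nat)))); lra.
Qed.

(** * Recurrent points with closed orbits *)

Lemma flow_inj_time x s t : ~ periodic phi x -> phi s x = phi t x -> s = t.
Proof.
intros Hx; assert (H : forall a b, a < b -> phi a x <> phi b x).
{ intros a b Hab He; apply Hx; exists (b - a); split; [lra|].
  intros c; replace (c + (b - a)) with (b + (c - a)) by ring.
  rewrite <- flow_flow, <- He, flow_flow; f_equal; ring. }
intros He; destruct (Rtotal_order s t) as [Hl|[Hl|Hl]]; [|exact Hl|].
- now destruct (H s t Hl).
- now destruct (H t s Hl).
Qed.

Lemma arc_distance x u n :
  (forall t, Rabs t <= n -> phi t x <> u) ->
  exists r, 0 < r /\ forall t, Rabs t <= n -> r <= d u (phi t x).
Proof.
intros Hu; apply NNPP; intros Hno.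
assert (H : forall k, exists t, Rabs t <= n /\ d u (phi t x) < / INR (S k)).
{ intros k; apply NNPP; intros Hq; apply Hno; exists (/ INR (S k)).
  split; [apply inv_S_pos|]; intros t Ht.
  destruct (Rlt_le_dec (d u (phi t x)) (/ INR (S k))) as [Hlt|]; [|assumption].
  exfalso; apply Hq; now exists t. }
apply choice in H; destruct H as [q Hq].
destruct (bounded_subsequence q n) as [g [t [Hg Ht]]]; [apply Hq|].
apply (Hu t).
- apply le_epsilon; intros eps He; destruct (Ht eps He) as [N HN].
  specialize (HN N (le_n _)); destruct (Hq (g N)) as [H1 _].
  pose proof (Rabs_triang_inv t (q (g N))); rewrite Rabs_minus_sym in HN; lra.
- apply (conv_unique (fun k => phi (q (g k)) x)).
  + apply flow_conv; [exact Ht|apply conv_const].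
  + intros eps He; destruct (inv_S_small eps He) as [N HN]; exists N; intros k Hk.
    rewrite dist_sym; eapply Rlt_trans; [apply Hq|].
    apply HN; pose proof (incr_ge g Hg k); lia.
Qed.

(* Baire's theorem on the orbit: recurrence makes every compact arc of a
   non-periodic orbit nowhere dense in that orbit. *)
Lemma recurrent_closed_orbit_periodic x :
  (forall r T, 0 < r -> exists t, T <= t /\ d x (phi t x) < r) ->
  closed_in d (orbit phi x) -> periodic phi x.
Proof.
intros Hrec Hcl; apply NNPP; intros Hper.
(* A pair (s, r) stands for the closed ball of radius r about [phi s x]. The new ball lies in the
   old one and misses the arc |t| <= n. Positivity of the radius is a premise under the existential
   so that [choice] yields a total function. *)
assert (Hstep : forall q : nat * (R * R), exists q' : R * R, 0 < snd (snd q) ->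
  0 < snd q' /\ snd q' < / INR (S (fst q)) /\
  (forall u, d (phi (fst q') x) u <= snd q' -> d (phi (fst (snd q)) x) u <= snd (snd q)) /\
  (forall t u, Rabs t <= INR (fst q) -> d (phi (fst q') x) u <= snd q' -> u <> phi t x)).
{ intros [n [s r]]; simpl.
  destruct (Rlt_le_dec 0 r) as [Hr|Hr]; [|exists (0, 0); simpl; intros; lra].
  destruct (flow_equicontinuous (Rabs s) (r / 2) ltac:(lra)) as [del [Hdel Heq]].
  (* So late a return puts [phi (T + s) x] within r/2 of the old centre but, the orbit being
     injective in time, off the arc |t| <= n. *)
  destruct (Hrec del (INR n + Rabs s + 1) Hdel) as [T [HT HTx]].
  assert (Hs := Heq s x (phi T x) (Rle_refl _) HTx); rewrite flow_flow in Hs.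
  pose proof (pos_INR n) as Hn.
  assert (HTs : INR n < T + s) by (pose proof (Rle_abs (- s)); rewrite Rabs_Ropp in *; lra).
  destruct (arc_distance x (phi (T + s) x) (INR n)) as [r1 [Hr1 Harc]].
  { intros t Ht He; apply (flow_inj_time x t (T + s) Hper) in He; subst t.
    rewrite Rabs_pos_eq in Ht; lra. }
  set (r' := Rmin (r / 2) (Rmin (r1 / 2) (/ INR (S n) / 2))).
  assert (Hr' : 0 < r' /\ r' <= r / 2 /\ r' <= r1 / 2 /\ r' <= / INR (S n) / 2).
  { pose proof (inv_S_pos n); unfold r'.
    pose proof (Rmin_l (r / 2) (Rmin (r1 / 2) (/ INR (S n) / 2))).
    pose proof (Rmin_r (r / 2) (Rmin (r1 / 2) (/ INR (S n) / 2))).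
    pose proof (Rmin_l (r1 / 2) (/ INR (S n) / 2)).
    pose proof (Rmin_r (r1 / 2) (/ INR (S n) / 2)).
    repeat split; try lra; repeat apply Rmin_pos; lra. }
  pose proof (inv_S_pos n).
  exists (T + s, r'); simpl; intros _; split; [lra|]; split; [simpl in *; lra|]; split.
  - intros u Hu; pose proof (dist_tri (phi s x) (phi (T + s) x) u); lra.
  - intros t u Ht Hu ->; specialize (Harc t Ht); lra. }
apply choice in Hstep; destruct Hstep as [e He].
set (c := fix c n := match n with O => (0, 1) | S n => e (n, c n) end).
assert (Hpos : forall n, 0 < snd (c n)).
{ induction n as [|n IH]; [simpl; lra|]; apply (He (n, c n)); exact IH. }
assert (Hnest : forall n k u, d (phi (fst (c (n + k)%nat)) x) u <= snd (c (n + k)%nat) ->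
  d (phi (fst (c n)) x) u <= snd (c n)).
{ intros n; induction k as [|k IH]; intros u Hu.
  - now rewrite Nat.add_0_r in Hu.
  - rewrite Nat.add_succ_r in Hu; apply IH.
    apply (proj1 (proj2 (proj2 (He (n + k, c (n + k))%nat (Hpos _))))); exact Hu. }
destruct (Hc (fun n => phi (fst (c n)) x)) as [g [l [Hg Hl]]].
assert (Hin : forall n, d (phi (fst (c n)) x) l <= snd (c n)).
{ intros n.
  apply (conv_dist_le (fun _ => phi (fst (c n)) x) (fun k => phi (fst (c (g k))) x) _ _ _ n).
  - apply conv_const.
  - exact Hl.
  - intros k Hk; apply (Hnest n (g k - n)%nat).
    pose proof (incr_ge g Hg k); replace (n + (g k - n))%nat with (g k) by lia.
    rewrite dist_self; left; apply Hpos. }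
destruct (Hcl (fun n => phi (fst (c (g n))) x) l) as [t Ht].
{ intros n; now exists (fst (c (g n))). }
{ exact Hl. }
destruct (INR_unbounded (Rabs t)) as [n Hn].
apply (proj2 (proj2 (proj2 (He (n, c n) (Hpos n)))) t l); [simpl; lra| |exact Ht].
exact (Hin (S n)).
Qed.

(** * Tracking of pseudo-orbits that return to a single point *)

Section Tracking.

Context (x : X) (e : R).

(** Strong shadowing weakened to a closed condition: the inequality is not strict and [h] is only
    bilipschitz, so limits of tracking points track. *)
Definition tracks (ts : Z -> R) (h : R -> R) (y : X) :=
  bilip h /\ forall i t, sseq ts i <= t <= sseq ts (i + 1)%Z ->
    d (phi (h t) y) (phi (t - sseq ts i) x) <= e.

Definition tracked ts y := exists h, tracks ts h y.

(** The time origin moves to step j; subtracting [h (sseq ts j)] makes the new reparametrization fix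
    0 again. *)
Lemma tracks_shift ts h y j :
  tracks ts h y ->
  tracks (fun i => ts (i + j)%Z) (fun t => h (t + sseq ts j) - h (sseq ts j))
    (phi (h (sseq ts j)) y).
Proof.
intros [H1 H2]; split; [now apply bilip_shift|].
intros i t Ht; rewrite !sseq_shift in Ht; rewrite sseq_shift, flow_flow.
replace (i + 1 + j)%Z with (i + j + 1)%Z in Ht by lia.
replace (h (sseq ts j) + _) with (h (t + sseq ts j)) by ring.
replace (t - _) with (t + sseq ts j - sseq ts (i + j)%Z) by ring.
apply H2; lra.
Qed.

Lemma tracked_dist ts y : 0 <= ts 0%Z -> tracked ts y -> d y x <= e.
Proof.
intros H0 [h [[Hh _] H]].
specialize (H 0%Z 0); rewrite sseq_succ, sseq_0, Rminus_0_r, Hh, !flow_0 in H.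
apply H; lra.
Qed.

(** Each s_i is a finite sum, hence eventually equal to its limit, so every single inequality passes
    to the limit along a subsequence of the reparametrizations. *)
Lemma tracked_closed (tsn : nat -> Z -> R) ts (yn : nat -> X) y :
  (forall i, exists n0, forall n, (n0 <= n)%nat -> tsn n i = ts i) ->
  seq_conv d yn y -> (forall n, tracked (tsn n) (yn n)) -> tracked ts y.
Proof.
intros Hts Hy Htr; apply choice in Htr; destruct Htr as [hn Hhn].
destruct (bilip_limit hn) as [g [h [Hg [Hh Hlim]]]]; [intros n; apply Hhn|].
exists h; split; [exact Hh|]; intros i t Ht.
destruct (sseq_eventually tsn ts Hts i) as [n1 H1].
destruct (sseq_eventually tsn ts Hts (i + 1)%Z) as [n2 H2].
apply (conv_dist_le (fun n => phi (hn (g n) t) (yn (g n)))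
  (fun _ => phi (t - sseq ts i) x) _ _ _ (n1 + n2)%nat).
- apply flow_conv; [apply Hlim|now apply conv_sub].
- apply conv_const.
- intros n Hn; pose proof (incr_ge g Hg n).
  destruct (Hhn (g n)) as [_ H3]; specialize (H3 i t).
  rewrite H1, H2 in H3 by lia; now apply H3.
Qed.

Lemma tracked_subsequence (tsn : nat -> Z -> R) ts (yn : nat -> X) :
  (forall i, exists n0, forall n, (n0 <= n)%nat -> tsn n i = ts i) ->
  (forall n, tracked (tsn n) (yn n)) ->
  exists g y, incr g /\ seq_conv d (fun n => yn (g n)) y /\ tracked ts y.
Proof.
intros Hts Htr; destruct (Hc yn) as [g [y [Hg Hy]]].
exists g, y; split; [exact Hg|]; split; [exact Hy|].
apply (tracked_closed (fun n => tsn (g n)) ts (fun n => yn (g n))); [|exact Hy|].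
- intros i; destruct (Hts i) as [n0 H]; exists n0; intros n Hn; apply H.
  pose proof (incr_ge g Hg n); lia.
- intros n; apply Htr.
Qed.

End Tracking.
(** * Distance to a set *)

Lemma distance_to_set (G : X -> Prop) :
  (exists u, G u) -> exists D : X -> R,
    (forall u, 0 <= D u) /\ (forall u v, D u <= D v + d u v) /\
    (forall u, G u -> D u = 0) /\ (closed_in d G -> forall u, D u = 0 -> G u).
Proof.
intros [g0 Hg0].
assert (H : forall u, exists c, (forall v, G v -> c <= d u v) /\
  forall eps, 0 < eps -> exists v, G v /\ d u v < c + eps).
{ intros u; destruct (completeness (fun r => exists v, G v /\ r = - d u v)) as [c [Hub Hlub]].
  - exists 0; intros r [v [_ ->]]; pose proof (dist_pos u v); lra.
  - exists (- d u g0), g0; now split.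
  - exists (- c); split.
    + intros v Hv; specialize (Hub (- d u v) (ex_intro _ v (conj Hv eq_refl))); lra.
    + intros eps He; apply NNPP; intros Hno.
      assert (c <= c - eps); [|lra].
      apply Hlub; intros r [v [Hv ->]].
      destruct (Rlt_le_dec (d u v) (- c + eps)) as [Hlt|]; [|lra].
      exfalso; apply Hno; now exists v. }
apply choice in H; destruct H as [D HD].
assert (Hpos : forall u, 0 <= D u).
{ intros u; apply le_epsilon; intros eps He.
  destruct (proj2 (HD u) eps He) as [v [_ Hv]]; pose proof (dist_pos u v); lra. }
exists D; split; [exact Hpos|]; split; [|split].
- intros u v; apply le_epsilon; intros eps He.
  destruct (proj2 (HD v) eps He) as [w [Hw Hvw]].
  pose proof (proj1 (HD u) w Hw); pose proof (dist_tri u v w); lra.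
- intros u Hu; pose proof (proj1 (HD u) u Hu) as H; rewrite dist_self in H.
  specialize (Hpos u); lra.
- intros Hcl u Hu.
  assert (H : forall n, exists v, G v /\ d u v < / INR (S n)).
  { intros n; destruct (proj2 (HD u) _ (inv_S_pos n)) as [v Hv].
    rewrite Hu, Rplus_0_l in Hv; now exists v. }
  apply choice in H; destruct H as [v Hv].
  apply (Hcl v u); [apply Hv|].
  intros eps He; destruct (inv_S_small eps He) as [N HN]; exists N; intros n Hn.
  rewrite dist_sym; eapply Rlt_trans; [apply Hv|now apply HN].
Qed.

Lemma lipschitz_conv (D : X -> R) :
  (forall u v, D u <= D v + d u v) ->
  forall u l, seq_conv d u l -> rconv (fun n => D (u n)) (D l).
Proof.
intros HD u l Hu eps He; destruct (Hu eps He) as [N HN]; exists N; intros n Hn.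
specialize (HN n Hn); pose proof (HD (u n) l) as H0; pose proof (HD l (u n)) as H.
rewrite dist_sym in H; apply Rabs_def1; lra.
Qed.

(** * Consequences of shadowing and expansivity *)

(** All points of the pseudo-orbit are taken equal to x, so the sequence of return times alone
    describes it. *)
Lemma shadowable_tracked x eps :
  strongly_shadowable d phi x -> 0 < eps -> eps <= 1/10 ->
  exists del, 0 < del /\ forall ts : Z -> R,
    (forall i, 1 <= ts i /\ d (phi (ts i) x) x < del) ->
    exists y, tracked x eps ts y /\ d y x < eps.
Proof.
intros Hsh He He1; destruct (Hsh eps He) as [del [Hdel H]].
exists del; split; [exact Hdel|]; intros ts Hts.
destruct (H None None (fun _ => x) ts) as [y [h [Hh Hy]]].
- now split.
- split; intros i; intros; apply Hts.
- reflexivity.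
- exists y; split.
  + exists h; split; [now apply (Rep_bilip eps)|].
    intros i t Ht; left; apply Hy; [now split|exact Ht].
  + assert (H0 := Hy 0%Z ltac:(now split) 0).
    rewrite sseq_succ, sseq_0, Rminus_0_r in H0.
    destruct Hh as [[_ [_ [_ Hh0]]] _]; rewrite Hh0, !(flow_0) in H0.
    apply H0; specialize (Hts 0%Z); lra.
Qed.

(** If h and k track with y and z, the reparametrization to compare them is k after the inverse of
    h: at corresponding times both points are e-close to the same point of the orbit of x. *)
Lemma expansive_tracked x e del (U : X -> Prop) :
  (forall u, d x u <= e -> U u) -> 2 * e < del ->
  (forall y z, U y -> U z -> forall h, reparam h ->
     (forall t, d (phi t y) (phi (h t) z) < del) ->
     exists t w, orbit phi z w /\ Rabs t < 1 /\ y = phi t w) ->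
  forall ts y z, (forall i, 1 <= ts i) ->
    tracked x e ts y -> tracked x e ts z -> orbit phi z y.
Proof.
intros HU Hdel Hexp ts y z Hts Hy Hz.
assert (HUy : U y).
{ apply HU; rewrite dist_sym; apply (tracked_dist x e ts); [specialize (Hts 0%Z); lra|exact Hy]. }
assert (HUz : U z).
{ apply HU; rewrite dist_sym; apply (tracked_dist x e ts); [specialize (Hts 0%Z); lra|exact Hz]. }
destruct Hy as [h [Hh Hy]]; destruct Hz as [k [Hk Hz]].
destruct (choice (fun t s => h s = t)) as [g Hg].
{ intros t; now apply bilip_surj. }
assert (Hmono : forall a b, a < b -> g a < g b).
{ intros a b Hab; apply (bilip_mono_inv h _ _ Hh); now rewrite !Hg. }
destruct (Hexp y z HUy HUz (fun t => k (g t))) as [t [w [[s Hw] [_ Hyw]]]].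
- split; [|split; [|split]].
  + intros a b Hab; apply bilip_mono; [exact Hk|now apply Hmono].
  + apply (lipschitz_continuity_pt _ (11/10 * (10/9))); [lra|]; intros a b.
    eapply Rle_trans; [now apply bilip_lipschitz|].
    rewrite Rmult_assoc; apply Rmult_le_compat_l; [lra|].
    assert (Hle : forall a b, a < b -> Rabs (g a - g b) <= 10/9 * Rabs (a - b)).
    { clear a b; intros a b Hab; specialize (Hmono a b Hab).
      pose proof (proj2 Hh (g a) (g b) ltac:(lra)) as H; rewrite !Hg in H.
      rewrite !Rabs_left by lra; lra. }
    destruct (Rtotal_order a b) as [Hab|[->|Hab]]; [now apply Hle| |].
    * rewrite !Rminus_diag, Rabs_R0; lra.
    * rewrite Rabs_minus_sym, (Rabs_minus_sym a); now apply Hle.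
  + intros c; destruct (bilip_surj k c Hk) as [a Ha].
    exists (h a); rewrite <- Ha; f_equal.
    destruct (Rtotal_order (g (h a)) a) as [Hl|[Hl|Hl]]; [|exact Hl|];
      apply (bilip_mono h _ _ Hh) in Hl; rewrite Hg in Hl; lra.
  + assert (Hg0 : g 0 = 0).
    { destruct (Rtotal_order (g 0) 0) as [Hl|[Hl|Hl]]; [|exact Hl|];
        apply (bilip_mono h _ _ Hh) in Hl; rewrite Hg, (proj1 Hh) in Hl; lra. }
    now rewrite Hg0; apply Hk.
- intros t; destruct (steps_locate (sseq ts) 1 ltac:(lra)) with (t := g t) as [i Hi].
  { intros i; rewrite sseq_succ; specialize (Hts i); lra. }
  specialize (Hy i (g t) ltac:(lra)); specialize (Hz i (g t) ltac:(lra)).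
  rewrite Hg in Hy; rewrite dist_sym in Hz.
  pose proof (dist_tri (phi t y) (phi (g t - sseq ts i) x) (phi (k (g t)) z)); lra.
- exists (s + t); rewrite Hyw, Hw; apply flow_flow.
Qed.

(** * Excursions away from a closed orbit *)

Section Marking.

Context (x : X) (e TA TB : R) (zA zB : X).
Hypothesis HTA : 1 <= TA.
Hypothesis HzA : tracked x e (fun _ => TA) zA.
Hypothesis HzA_unique : forall y, tracked x e (fun _ => TA) y -> orbit phi zA y.

(** A constant sequence is invariant under index shifts, so the orbit of [zA] meets the set of
    tracking points within every time span 11/10 * TA. A limit of orbit points is thus a bounded
    flow time away from a limit of tracking points, which tracks too and so lies on the orbit. *)
Lemma constant_tracked_orbit_closed : closed_in d (orbit phi zA).
Proof.
intros u l Hu Hl; destruct HzA as [h Hh].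
assert (H : forall n, exists q : Z * R, 0 <= snd q <= 11/10 * TA /\
  u n = phi (snd q) (phi (h (sseq (fun _ => TA) (fst q))) zA)).
{ intros n; destruct (Hu n) as [t Ht].
  destruct (steps_locate (fun i => h (sseq (fun _ => TA) i)) (9/10) ltac:(lra)) with (t := t)
    as [i Hi].
  { intros i; rewrite sseq_succ.
    pose proof (proj2 (proj1 Hh) (sseq (fun _ => TA) i) (sseq (fun _ => TA) i + TA)
      ltac:(lra)); lra. }
  exists (i, t - h (sseq (fun _ => TA) i)); simpl.
  rewrite sseq_succ in Hi.
  pose proof (proj2 (proj1 Hh) (sseq (fun _ => TA) i) (sseq (fun _ => TA) i + TA) ltac:(lra)).
  split; [lra|]; rewrite flow_flow, Ht; f_equal; ring. }
apply choice in H; destruct H as [q Hq].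
destruct (tracked_subsequence x e (fun _ _ => TA) (fun _ => TA)
  (fun n => phi (h (sseq (fun _ => TA) (fst (q n)))) zA)) as [g [y [Hg [Hy Hty]]]].
{ intros i; now exists 0%nat. }
{ intros n; eexists.
  exact (tracks_shift x e (fun _ => TA) h zA (fst (q n)) Hh). }
destruct (bounded_subsequence (fun n => snd (q (g n))) (11/10 * TA)) as [g' [s [Hg' Hs]]].
{ intros n; apply Rabs_le; destruct (Hq (g n)); lra. }
destruct (HzA_unique y Hty) as [t ->].
exists (t + s); rewrite <- flow_flow.
apply (conv_unique (fun n => u (g (g' n)))).
- apply (conv_sub u l (fun n => g (g' n))); [exact Hl|exact (incr_comp g g' Hg Hg')].
- pose proof (flow_conv _ _ _ _ Hs (conv_sub _ _ g' Hy Hg')) as H.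
  intros eps He; destruct (H eps He) as [N HN]; exists N; intros n Hn.
  rewrite (proj2 (Hq (g (g' n)))); now apply HN.
Qed.

Context (D : X -> R).
Hypothesis HD : forall u v, D u <= D v + d u v.
Hypothesis HDA : forall u, orbit phi zA u -> D u = 0.

(** Sequences equal to TA on growing windows converge to the constant one, whose tracking points lie
    on the orbit of [zA], where [D] vanishes. *)
Lemma tracked_near_closed_orbit rho W :
  0 < rho -> exists N : nat, forall ts y s,
    (forall i, (Z.abs i <= Z.of_nat N)%Z -> ts i = TA) -> tracked x e ts y ->
    Rabs s <= W -> D (phi s y) < rho.
Proof.
intros Hrho; apply NNPP; intros Hno.
assert (H : forall n : nat, exists q : (Z -> R) * X * R,
  (forall i, (Z.abs i <= Z.of_nat n)%Z -> fst (fst q) i = TA) /\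
  tracked x e (fst (fst q)) (snd (fst q)) /\ Rabs (snd q) <= W /\
  rho <= D (phi (snd q) (snd (fst q)))).
{ intros n; apply NNPP; intros Hq; apply Hno; exists n; intros ts y s H1 H2 H3.
  destruct (Rlt_le_dec (D (phi s y)) rho) as [|Hle]; [assumption|].
  exfalso; apply Hq; now exists (ts, y, s). }
apply choice in H; destruct H as [q Hq].
destruct (tracked_subsequence x e (fun n => fst (fst (q n))) (fun _ => TA)
  (fun n => snd (fst (q n)))) as [g [y [Hg [Hy Hty]]]].
{ intros i; exists (Z.abs_nat i); intros n Hn; apply (Hq n); lia. }
{ intros n; apply Hq. }
destruct (bounded_subsequence (fun n => snd (q (g n))) W) as [g' [s [Hg' Hs]]].
{ intros n; apply Hq. }
pose proof (flow_conv _ _ _ _ Hs (conv_sub _ _ g' Hy Hg')) as H.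
destruct (lipschitz_conv D HD _ _ H rho Hrho) as [N HN].
specialize (HN N (le_n _)); apply Rabs_def2 in HN.
rewrite (HDA (phi s y)) in HN.
- destruct (Hq (g (g' N))) as [_ [_ [_ Hr]]]; lra.
- destruct (HzA_unique y Hty) as [t ->]; exists (t + s); apply flow_flow.
Qed.

Hypothesis HD0 : forall u, 0 <= D u.
Hypothesis HDA' : forall u, D u = 0 -> orbit phi zA u.
Hypothesis HzB : ~ orbit phi zA zB.
Hypothesis HzB_unique : forall y, tracked x e (fun _ => TB) y -> orbit phi zB y.

Definition marked (m : nat) (i : Z) : R := if (Z.abs i <=? Z.of_nat m)%Z then TB else TA.

(** Two limits. If for every m a point on the orbit of [zA] tracked [marked m], a limit would track
    constant TB and lie on that closed orbit, forcing [zB] onto it. For the m so found, a second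
    compactness argument gives the window N and the distance rho. *)
Lemma tracked_far_from_closed_orbit :
  exists (m N : nat) rho, 0 < rho /\ forall ts y,
    (forall i, (Z.abs i <= Z.of_nat N)%Z -> ts i = marked m i) -> tracked x e ts y ->
    2 * rho < D y.
Proof.
assert (Hm : exists m, forall y, tracked x e (marked m) y -> ~ orbit phi zA y).
{ apply NNPP; intros Hno.
  assert (H : forall m, exists y, tracked x e (marked m) y /\ orbit phi zA y).
  { intros m; apply NNPP; intros Hq; apply Hno; exists m; intros y H1 H2.
    apply Hq; now exists y. }
  apply choice in H; destruct H as [y Hy].
  destruct (tracked_subsequence x e marked (fun _ => TB) y) as [g [l [Hg [Hl Htl]]]].
  { intros i; exists (Z.abs_nat i); intros n Hn; unfold marked.
    destruct (Z.leb_spec (Z.abs i) (Z.of_nat n)); [reflexivity|lia]. }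
  { intros n; apply Hy. }
  assert (Hol : orbit phi zA l).
  { apply (constant_tracked_orbit_closed (fun n => y (g n))); [intros n; apply Hy|exact Hl]. }
  destruct Hol as [s ->]; destruct (HzB_unique _ Htl) as [t Ht].
  apply HzB; exists (s - t).
  symmetry in Ht; apply flow_cancel in Ht; rewrite Ht, flow_flow; reflexivity. }
destruct Hm as [m Hm]; exists m; apply NNPP; intros Hno.
assert (H : forall n : nat, exists q : (Z -> R) * X,
  (forall i, (Z.abs i <= Z.of_nat n)%Z -> fst q i = marked m i) /\
  tracked x e (fst q) (snd q) /\ D (snd q) <= 2 * / INR (S n)).
{ intros n; apply NNPP; intros Hq; apply Hno; exists n, (/ INR (S n)).
  split; [apply inv_S_pos|]; intros ts y H1 H2.
  destruct (Rlt_le_dec (2 * / INR (S n)) (D y)) as [|Hle]; [assumption|].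
  exfalso; apply Hq; now exists (ts, y). }
apply choice in H; destruct H as [q Hq].
destruct (tracked_subsequence x e (fun n => fst (q n)) (marked m)
  (fun n => snd (q n))) as [g [y [Hg [Hy Hty]]]].
{ intros i; exists (Z.abs_nat i); intros n Hn; apply (Hq n); lia. }
{ intros n; apply Hq. }
apply (Hm y Hty), HDA', Rle_antisym; [|apply HD0].
apply le_epsilon; intros eps He.
destruct (lipschitz_conv D HD _ _ Hy (eps / 2) ltac:(lra)) as [N HN].
destruct (inv_S_small (eps / 4) ltac:(lra)) as [M HM].
specialize (HN (N + M)%nat ltac:(lia)).
pose proof (incr_ge g Hg (N + M)%nat); specialize (HM (g (N + M)%nat) ltac:(lia)).
destruct (Hq (g (N + M)%nat)) as [_ [_ Hr]]; apply Rabs_def2 in HN; lra.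
Qed.

End Marking.

Lemma marked_excursions x :
  nonwandering d phi x -> ~ periodic phi x ->
  strongly_shadowable d phi x -> uniformly_expansive d phi x ->
  exists (e TA TB : R) (D : X -> R) (m N : nat) (rho : R),
    (1 <= TA /\ 1 <= TB /\ 0 < rho) /\
    (forall u v, D u <= D v + d u v) /\
    (forall ts, (forall i, ts i = TA \/ ts i = TB) -> exists y, tracked x e ts y) /\
    (forall ts, (forall i, ts i = TA \/ ts i = TB) ->
       forall y z, tracked x e ts y -> tracked x e ts z -> orbit phi z y) /\
    (forall ts y s, (forall i, (Z.abs i <= Z.of_nat N)%Z -> ts i = TA) ->
       tracked x e ts y -> Rabs s <= 2 * TA -> D (phi s y) < rho) /\
    (forall ts y, (forall i, (Z.abs i <= Z.of_nat N)%Z -> ts i = marked TA TB m i) ->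
       tracked x e ts y -> 2 * rho < D y).
Proof.
intros Hnw Hper Hsh [U [[r0 [Hr0 HU]] Hexp]].
destruct (Hexp 1 ltac:(lra)) as [del [Hdel Hexp1]]; clear Hexp.
(* Wandering is defined through the orbit of x itself, so its negation gives arbitrarily late
   returns of x. *)
assert (Hrec : forall r T, 0 < r -> exists t, T <= t /\ d x (phi t x) < r).
{ intros r T Hr; apply NNPP; intros Hno; apply Hnw.
  exists (fun u => d x u < r); split; [exists r; now split|].
  exists (Rmax T 1); split; [pose proof (Rmax_r T 1); lra|].
  intros t Ht Hd'; apply Hno; exists t; split; [pose proof (Rmax_l T 1); lra|exact Hd']. }
(* The bound 1/10 makes reparametrizations bilipschitz, r0/2 puts tracking points into [U], and
   del/3 gives 2e < del for expansivity. *)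
set (e := Rmin (1/10) (Rmin (r0 / 2) (del / 3))).
assert (He : 0 < e /\ e <= 1/10 /\ e <= r0 / 2 /\ e <= del / 3).
{ unfold e; pose proof (Rmin_l (1/10) (Rmin (r0 / 2) (del / 3))).
  pose proof (Rmin_r (1/10) (Rmin (r0 / 2) (del / 3))).
  pose proof (Rmin_l (r0 / 2) (del / 3)); pose proof (Rmin_r (r0 / 2) (del / 3)).
  repeat split; try lra; repeat apply Rmin_pos; lra. }
clearbody e.
assert (Huniq : forall ts, (forall i, 1 <= ts i) ->
  forall y z, tracked x e ts y -> tracked x e ts z -> orbit phi z y).
{ intros ts Hts y z; apply (expansive_tracked x e del U); [| |exact Hexp1|exact Hts].
  - intros u Hu; apply HU; lra.
  - lra. }
destruct (shadowable_tracked x e Hsh) as [del0 [Hdel0 Hsh0]]; [lra|lra|].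
destruct (Hrec del0 1 Hdel0) as [TA [HTA HTAx]]; rewrite dist_sym in HTAx.
destruct (Hsh0 (fun _ => TA)) as [zA [HzA _]]; [intros; lra|].
assert (HuA : forall y, tracked x e (fun _ => TA) y -> orbit phi zA y).
{ intros y Hy; exact (Huniq _ (fun _ => HTA) y zA Hy HzA). }
pose proof (constant_tracked_orbit_closed x e TA zA HTA HzA HuA) as HclA.
(* If x were on the closed orbit, its own orbit would be closed, and a recurrent point with closed
   orbit is periodic. *)
assert (HxA : ~ orbit phi zA x).
{ intros [s Hs]; apply Hper, recurrent_closed_orbit_periodic; [exact Hrec|].
  intros u l Hu Hl; destruct (HclA u l) as [t Ht].
  - intros n; destruct (Hu n) as [t Ht]; exists (s + t); now rewrite <- flow_flow, <- Hs.
  - exact Hl.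
  - exists (t - s); rewrite Hs, flow_flow, Ht; f_equal; ring. }
destruct (distance_to_set (orbit phi zA)) as [D [HD0 [HD [HDA HDA']]]].
{ exists zA, 0; now rewrite flow_0. }
specialize (HDA' HclA).
assert (HDx : 0 < D x).
{ destruct (HD0 x) as [|H]; [assumption|]; destruct HxA; now apply HDA'. }
(* A point strictly closer to x than [D x] cannot be on the orbit of [zA]; this separates [zB] from
   it. *)
set (e1 := Rmin e (D x)).
assert (He1 : 0 < e1 /\ e1 <= e /\ e1 <= D x).
{ unfold e1; pose proof (Rmin_l e (D x)); pose proof (Rmin_r e (D x)).
  repeat split; try lra; apply Rmin_pos; lra. }
clearbody e1.
destruct (shadowable_tracked x e1 Hsh) as [del1 [Hdel1 Hsh1]]; [lra|lra|].
(* Closeness [del1] serves the fine tracking of constant TB, closeness [del0] the tracking at scale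
   e of sequences mixing TA and TB. *)
destruct (Hrec (Rmin del0 del1) 1) as [TB [HTB HTBx]]; [now apply Rmin_pos|].
rewrite dist_sym in HTBx.
pose proof (Rmin_l del0 del1); pose proof (Rmin_r del0 del1).
destruct (Hsh1 (fun _ => TB)) as [zB [[h [Hh HzB]] HzBx]]; [intros; lra|].
assert (HtB : tracked x e (fun _ => TB) zB).
{ exists h; split; [exact Hh|]; intros i t Ht; specialize (HzB i t Ht); lra. }
assert (HuB : forall y, tracked x e (fun _ => TB) y -> orbit phi zB y).
{ intros y Hy; exact (Huniq _ (fun _ => HTB) y zB Hy HtB). }
assert (HzBA : ~ orbit phi zA zB).
{ intros Ho; apply HDA in Ho; pose proof (HD x zB) as H1; rewrite dist_sym in H1; lra. }
destruct (tracked_far_from_closed_orbit x e TA TB zA zB HTA HzA HuA D HD HD0 HDA' HzBA HuB)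
  as [m [N1 [rho [Hrho Hfar]]]].
destruct (tracked_near_closed_orbit x e TA zA HuA D HD HDA rho (2 * TA) Hrho)
  as [N2 Hnear].
assert (Hval : forall ts : Z -> R, (forall i, ts i = TA \/ ts i = TB) -> forall i, 1 <= ts i).
{ intros ts Hts i; destruct (Hts i); lra. }
exists e, TA, TB, D, m, (N1 + N2)%nat, rho.
split; [lra|]; split; [exact HD|]; split; [|split; [|split]].
- intros ts Hts; destruct (Hsh0 ts) as [y [Hy _]]; [|now exists y].
  intros i; destruct (Hts i) as [-> | ->]; lra.
- intros ts Hts; apply Huniq; now apply Hval.
- intros ts y s Hts; apply Hnear; intros i Hi; apply Hts; lia.
- intros ts y Hts; apply Hfar; intros i Hi; apply Hts; lia.
Qed.
(** * Symbolic coding *)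

(** Let p (i+1) be matched to q j'. If j' <= j, then p (i+1) - p i is at most 2C. If j' > j + 1,
    then q (j+1) lies too far above p i and too far below p (i+1) to have a partner. *)
Lemma matching_step (p q : Z -> R) C G :
  4 * C < G ->
  (forall i, G <= p (i + 1)%Z - p i) -> (forall j, G <= q (j + 1)%Z - q j) ->
  (forall i, exists j, Rabs (p i - q j) <= C) ->
  (forall j, exists i, Rabs (p i - q j) <= C) ->
  forall i j, Rabs (p i - q j) <= C -> Rabs (p (i + 1)%Z - q (j + 1)%Z) <= C.
Proof.
intros HG Hp Hq Hpq Hqp i j Hij.
assert (HC : 0 <= C) by (pose proof (Rabs_pos (p i - q j)); lra).
assert (mono : forall a : Z -> R, (forall i, G <= a (i + 1)%Z - a i) ->
  forall i j, (i <= j)%Z -> a i <= a j).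
{ intros a Ha k l Hkl; pose proof (steps_lower a G Ha k l Hkl) as H.
  assert (0 <= IZR (l - k)) by (apply IZR_le; lia).
  pose proof (Rmult_le_pos (IZR (l - k)) G); lra. }
apply Rabs_le_inv in Hij.
destruct (Hpq (i + 1)%Z) as [j' Hj']; apply Rabs_le_inv in Hj'.
destruct (Z.lt_trichotomy j' (j + 1)) as [Hl|[->|Hl]]; [|apply Rabs_le; lra|]; exfalso.
- pose proof (mono q Hq j' j ltac:(lia)); specialize (Hp i); lra.
- pose proof (mono q Hq (j + 1 + 1)%Z j' ltac:(lia)); pose proof (Hq (j + 1)%Z).
  destruct (Hqp (j + 1)%Z) as [i' Hi']; apply Rabs_le_inv in Hi'.
  destruct (Z_le_gt_dec i' i) as [Hii|Hii].
  + pose proof (mono p Hp i' i Hii); pose proof (Hq j); lra.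
  + pose proof (mono p Hp (i + 1)%Z i' ltac:(lia)); lra.
Qed.

Lemma matching (p q : Z -> R) C G :
  4 * C < G ->
  (forall i, G <= p (i + 1)%Z - p i) -> (forall j, G <= q (j + 1)%Z - q j) ->
  (forall i, exists j, Rabs (p i - q j) <= C) ->
  (forall j, exists i, Rabs (p i - q j) <= C) ->
  forall i j, Rabs (p i - q j) <= C ->
  forall n, Rabs (p (i + n)%Z - q (j + n)%Z) <= C.
Proof.
intros HG Hp Hq Hpq Hqp i j Hij; apply Z.peano_ind.
- now rewrite !Z.add_0_r.
- intros n Hn.
  replace (i + Z.succ n)%Z with (i + n + 1)%Z by lia.
  replace (j + Z.succ n)%Z with (j + n + 1)%Z by lia.
  now apply (matching_step p q C G).
- intros n Hn.
  assert (Hopp : forall a b, Rabs (- a - - b) = Rabs (a - b)).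
  { intros a b; replace (- a - - b) with (- (a - b)) by ring; apply Rabs_Ropp. }
  (* A downward step is an upward step for the sequences reflected in index and value. *)
  pose proof (matching_step (fun k => - p (- k)%Z) (fun k => - q (- k)%Z) C G HG) as H.
  replace (i + Z.pred n)%Z with (- (- (i + n) + 1))%Z by lia.
  replace (j + Z.pred n)%Z with (- (- (j + n) + 1))%Z by lia.
  rewrite <- Hopp; apply H; clear H.
  + intros k; specialize (Hp (- (k + 1))%Z).
    replace (- (k + 1) + 1)%Z with (- k)%Z in Hp by lia; lra.
  + intros k; specialize (Hq (- (k + 1))%Z).
    replace (- (k + 1) + 1)%Z with (- k)%Z in Hq by lia; lra.
  + intros k; destruct (Hpq (- k)%Z) as [l Hl]; exists (- l)%Z.
    now rewrite Z.opp_involutive, Hopp.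
  + intros k; destruct (Hqp (- k)%Z) as [l Hl]; exists (- l)%Z.
    now rewrite Z.opp_involutive, Hopp.
  + now rewrite !Z.opp_involutive, Hopp.
Qed.

Lemma sseq_IZR (f : Z -> Z) i : exists z, sseq (fun k => IZR (f k)) i = IZR z.
Proof.
revert i; apply Z.peano_ind.
- now exists 0%Z.
- intros i [z Hz]; exists (z + f i)%Z.
  now rewrite <- Z.add_1_r, sseq_succ, Hz, plus_IZR.
- intros i [z Hz]; exists (z - f (Z.pred i))%Z.
  pose proof (sseq_succ (fun k => IZR (f k)) (Z.pred i)) as H.
  replace (Z.pred i + 1)%Z with i in H by lia; rewrite minus_IZR; lra.
Qed.

Lemma Int_part_IZR z : Int_part (IZR z) = z.
Proof.
destruct (base_Int_part (IZR z)) as [H1 H2].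
apply le_IZR in H1.
assert (IZR z < IZR (Int_part (IZR z) + 1)) as H by (rewrite plus_IZR; lra).
apply lt_IZR in H; lia.
Qed.

Definition shiftn (j : Z) (w : Z -> nat) : Z -> nat := fun i => w (i + j)%Z.

(** Position, in the sequence of return times, of the middle of block i: letter a is followed by a +
    1 times M steps. The two-sided sum reuses the real-valued [sseq], whose values here are
    integers. *)
Definition center (M : Z) (w : Z -> nat) (i : Z) : Z :=
  Int_part (sseq (fun k => IZR ((Z.of_nat (w k) + 1) * M)) i).

Lemma center_IZR M w i :
  IZR (center M w i) = sseq (fun k => IZR ((Z.of_nat (w k) + 1) * M)) i.
Proof.
unfold center; destruct (sseq_IZR (fun k => (Z.of_nat (w k) + 1) * M)%Z i) as [z ->].
now rewrite Int_part_IZR.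
Qed.

Lemma center_0 M w : center M w 0 = 0%Z.
Proof. apply eq_IZR; now rewrite center_IZR. Qed.

Lemma center_succ M w i :
  center M w (i + 1) = (center M w i + (Z.of_nat (w i) + 1) * M)%Z.
Proof. apply eq_IZR; now rewrite plus_IZR, !center_IZR, sseq_succ. Qed.

Lemma center_shiftn M w j i :
  center M (shiftn j w) i = (center M w (i + j) - center M w j)%Z.
Proof.
apply eq_IZR; rewrite minus_IZR, !center_IZR.
exact (sseq_shift (fun k => IZR ((Z.of_nat (w k) + 1) * M)) j i).
Qed.

Lemma center_gap M w i j :
  (0 <= M)%Z -> (i <= j)%Z -> ((j - i) * M <= center M w j - center M w i)%Z.
Proof.
intros HM Hij; apply le_IZR; rewrite mult_IZR, (minus_IZR (center M w j)).
apply (steps_lower (fun i => IZR (center M w i))); [|exact Hij].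
intros k; rewrite <- minus_IZR; apply IZR_le; rewrite center_succ; nia.
Qed.

Lemma center_agree M w w' K :
  agree_on K w w' -> forall i, (Z.abs i <= Z.of_nat K)%Z -> center M w i = center M w' i.
Proof.
intros H.
assert (Hn : forall n, (n <= K)%nat ->
  center M w (Z.of_nat n) = center M w' (Z.of_nat n) /\
  center M w (- Z.of_nat n) = center M w' (- Z.of_nat n)).
{ induction n as [|n IH]; intros Hn; [now rewrite !center_0|].
  destruct (IH ltac:(lia)) as [IH1 IH2]; split.
  - replace (Z.of_nat (S n)) with (Z.of_nat n + 1)%Z by lia.
    rewrite !center_succ, IH1, (H (Z.of_nat n)) by lia; reflexivity.
  - pose proof (center_succ M w (- Z.of_nat (S n))) as H1.
    pose proof (center_succ M w' (- Z.of_nat (S n))) as H2.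
    replace (- Z.of_nat (S n) + 1)%Z with (- Z.of_nat n)%Z in H1, H2 by lia.
    rewrite <- (H (- Z.of_nat (S n))%Z) in H2 by lia; lia. }
intros i Hi; destruct (Hn (Z.to_nat (Z.abs i)) ltac:(lia)) as [H1 H2].
rewrite Z2Nat.id in H1, H2 by lia.
destruct (Z.abs_eq_or_opp i) as [He|He]; rewrite He in H1, H2; [exact H1|].
now rewrite Z.opp_involutive in H2.
Qed.

(** * Reading a word off the orbit of a tracking point *)

Section Coding.

Context (x : X) (e TA TB : R) (D : X -> R) (m N : nat) (rho : R) (M : Z).
Hypothesis HTA : 1 <= TA.
Hypothesis HTB : 1 <= TB.
Hypothesis Hrho : 0 < rho.
Hypothesis HD : forall u v, D u <= D v + d u v.
Hypothesis Hexists :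
  forall ts, (forall i, ts i = TA \/ ts i = TB) -> exists y, tracked x e ts y.
Hypothesis Hunique :
  forall ts, (forall i, ts i = TA \/ ts i = TB) ->
    forall y z, tracked x e ts y -> tracked x e ts z -> orbit phi z y.
Hypothesis Hnear :
  forall ts y s, (forall i, (Z.abs i <= Z.of_nat N)%Z -> ts i = TA) ->
    tracked x e ts y -> Rabs s <= 2 * TA -> D (phi s y) < rho.
Hypothesis Hfar :
  forall ts y, (forall i, (Z.abs i <= Z.of_nat N)%Z -> ts i = marked TA TB m i) ->
    tracked x e ts y -> 2 * rho < D y.

(* Bounds the duration of an excursion from the closed orbit around a mark. *)
Definition width : R := 2 * (INR m + INR N + 1) * (TA + TB).

(** Sparse marks: the errors in the decoding are small multiples of [width], hence small against the
    distance between marks. *)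
Hypothesis HM : 100 * width <= IZR M.

Lemma width_ge : 4 * (INR m + INR N + 1) <= width.
Proof.
unfold width; pose proof (pos_INR m); pose proof (pos_INR N); nra.
Qed.

Lemma width_pos : 4 <= width.
Proof. pose proof width_ge; pose proof (pos_INR m); pose proof (pos_INR N); lra. Qed.

Lemma M_large : (100 * (Z.of_nat m + Z.of_nat N + 1) <= M)%Z.
Proof.
apply le_IZR; rewrite mult_IZR, !plus_IZR, <- !INR_IZR_INZ.
pose proof width_ge; pose proof (pos_INR m); pose proof (pos_INR N); lra.
Qed.

Definition times (w : Z -> nat) (k : Z) : R :=
  if excluded_middle_informative (exists i, (Z.abs (k - center M w i) <= Z.of_nat m)%Z)
  then TB else TA.

Lemma times_valid w i : times w i = TA \/ times w i = TB.
Proof. unfold times; destruct excluded_middle_informative; [now right|now left]. Qed.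

Lemma times_shiftn j w k : times (shiftn j w) k = times w (k + center M w j).
Proof.
unfold times.
destruct excluded_middle_informative as [[i Hi]|H1];
  destruct excluded_middle_informative as [[l Hl]|H2]; try reflexivity; exfalso.
- apply H2; exists (i + j)%Z; rewrite center_shiftn in Hi.
  now replace (k + center M w j - center M w (i + j))%Z
    with (k - (center M w (i + j) - center M w j))%Z by lia.
- apply H1; exists (l - j)%Z; rewrite center_shiftn.
  replace (l - j + j)%Z with l by lia.
  now replace (k - (center M w l - center M w j))%Z
    with (k + center M w j - center M w l)%Z by lia.
Qed.

(** Makes the return time at index k depend only on letters at distance at most |k| + m, which gives
    [times_agree]. *)
Lemma center_abs w i : (Z.abs i <= Z.abs (center M w i))%Z.
Proof.
pose proof M_large; pose proof (center_0 M w).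
destruct (Z_le_gt_dec 0 i).
- pose proof (center_gap M w 0 i ltac:(lia) ltac:(lia)); nia.
- pose proof (center_gap M w i 0 ltac:(lia) ltac:(lia)); nia.
Qed.

Lemma times_agree K w w' k :
  agree_on K w w' -> (Z.abs k + Z.of_nat m <= Z.of_nat K)%Z -> times w k = times w' k.
Proof.
intros H Hk.
assert (Hsym : agree_on K w' w) by (intros i Hi; symmetry; now apply H).
unfold times.
destruct excluded_middle_informative as [[i Hi]|H1];
  destruct excluded_middle_informative as [[l Hl]|H2]; try reflexivity; exfalso.
- apply H2; exists i; pose proof (center_abs w i).
  now rewrite <- (center_agree M w w' K H) by lia.
- apply H1; exists l; pose proof (center_abs w' l).
  now rewrite (center_agree M w w' K H) by lia.
Qed.

Lemma times_pos w i : 1 <= times w i <= TA + TB.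
Proof. destruct (times_valid w i) as [-> | ->]; lra. Qed.

Lemma sseq_times_le w a b :
  Rabs (sseq (times w) a - sseq (times w) b) <= IZR (Z.abs (a - b)) * (TA + TB).
Proof.
assert (H : forall a b, (a <= b)%Z ->
  Rabs (sseq (times w) a - sseq (times w) b) <= IZR (Z.abs (a - b)) * (TA + TB)).
{ clear a b; intros a b Hab.
  pose proof (steps_lower (sseq (times w)) 1) as H1.
  pose proof (steps_upper (sseq (times w)) (TA + TB)) as H2.
  specialize (H1 ltac:(intros i; rewrite sseq_succ; pose proof (times_pos w i); lra) a b Hab).
  specialize (H2 ltac:(intros i; rewrite sseq_succ; pose proof (times_pos w i); lra) a b Hab).
  assert (0 <= IZR (b - a)) by (apply IZR_le; lia).
  rewrite Rabs_minus_sym, Rabs_pos_eq by lra.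
  now replace (Z.abs (a - b)) with (b - a)%Z by lia. }
destruct (Z_le_gt_dec a b); [now apply H|].
rewrite Rabs_minus_sym, <- Z.abs_opp, Z.opp_sub_distr, Z.add_comm.
apply H; lia.
Qed.

Definition mark_time (w : Z -> nat) (h : R -> R) (i : Z) : R := h (sseq (times w) (center M w i)).

Lemma mark_time_0 w h : bilip h -> mark_time w h 0 = 0.
Proof. intros [H0 _]; unfold mark_time; now rewrite center_0, sseq_0. Qed.

(** Carries facts proved at mark 0 to every mark: shifting the word by j letters amounts to flowing
    up to mark j. *)
Lemma tracks_mark w h y j :
  tracks x e (times w) h y ->
  exists h', tracks x e (times (shiftn j w)) h' (phi (mark_time w h j) y) /\
    forall i, mark_time (shiftn j w) h' i = mark_time w h (i + j) - mark_time w h j.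
Proof.
intros H; exists (fun t => h (t + sseq (times w) (center M w j)) - mark_time w h j).
assert (Hs : forall i, sseq (times (shiftn j w)) i
  = sseq (times w) (i + center M w j) - sseq (times w) (center M w j)).
{ intros i; rewrite <- sseq_shift; symmetry; apply sseq_unique; [apply sseq_0|].
  intros k; now rewrite sseq_succ, times_shiftn. }
split.
- destruct (tracks_shift x e (times w) h y (center M w j) H) as [H1 H2].
  split; [exact H1|]; intros i t Ht.
  specialize (H2 i t); rewrite !Hs in *; rewrite !sseq_shift in H2; now apply H2.
- intros i; unfold mark_time at 1; rewrite Hs, center_shiftn.
  unfold mark_time; do 2 f_equal.
  replace (center M w (i + j) - center M w j + center M w j)%Z
    with (center M w (i + j)) by lia; ring.
Qed.

Lemma times_center w i : 
  (Z.abs i <= Z.of_nat N)%Z -> times w i = marked TA TB m i.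
Proof.
intros Hi; pose proof M_large; unfold times, marked.
destruct excluded_middle_informative as [[k Hk]|H1]; destruct (Z.leb_spec (Z.abs i) (Z.of_nat m));
  try reflexivity; exfalso.
- pose proof (center_0 M w).
  destruct (Z.lt_trichotomy k 0) as [Hl|[->|Hl]]; [|lia|].
  + pose proof (center_gap M w k 0 ltac:(lia) ltac:(lia)); nia.
  + pose proof (center_gap M w 0 k ltac:(lia) ltac:(lia)); nia.
- apply H1; exists 0%Z; now rewrite center_0, Z.sub_0_r.
Qed.

Lemma mark_far w h y i :
  tracks x e (times w) h y -> 2 * rho < D (phi (mark_time w h i) y).
Proof.
intros H; destruct (tracks_mark w h y i H) as [h' [H' _]].
apply (Hfar (times (shiftn i w))); [|now exists h'].
intros k Hk; now apply times_center.
Qed.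

Lemma bilip_abs h a b c : bilip h -> Rabs (a - b) <= c -> Rabs (h a - h b) <= 11/10 * c.
Proof. intros Hh Hab; pose proof (bilip_lipschitz h a b Hh); lra. Qed.

(** Let t fall in step k. If k is within m + N of a centre, the elapsed time is at most [width].
    Otherwise all indices within N of k carry TA, and [Hnear] applies, a step lasting at most 11/10
    * TA. *)
Lemma far_near_mark w h y t :
  tracks x e (times w) h y -> rho <= D (phi t y) ->
  exists i, Rabs (t - mark_time w h i) <= width.
Proof.
intros H Ht.
assert (Hstep : forall i, 9/10 <= h (sseq (times w) (i + 1)) - h (sseq (times w) i)
  <= 11/10 * times w i).
{ intros i; rewrite sseq_succ; pose proof (times_pos w i).
  pose proof (proj2 (proj1 H) (sseq (times w) i) (sseq (times w) i + times w i) ltac:(lra)); lra. }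
destruct (steps_locate (fun i => h (sseq (times w) i)) (9/10) ltac:(lra)) with (t := t)
  as [k Hk]; [intros i; apply Hstep|].
specialize (Hstep k).
destruct (classic (exists i, (Z.abs (k - center M w i) <= Z.of_nat (m + N))%Z)) as [[i Hi]|Hno].
- exists i; unfold mark_time.
  pose proof (sseq_times_le w k (center M w i)) as H1.
  apply (bilip_abs h) in H1; [|apply H].
  assert (H2 : IZR (Z.abs (k - center M w i)) <= INR m + INR N).
  { rewrite <- plus_INR, INR_IZR_INZ; now apply IZR_le. }
  pose proof (times_pos w k).
  assert (IZR (Z.abs (k - center M w i)) * (TA + TB) <= (INR m + INR N) * (TA + TB))
    by (apply Rmult_le_compat_r; lra).
  pose proof (pos_INR m); pose proof (pos_INR N).
  assert (0 <= (INR m + INR N) * (TA + TB)) by (apply Rmult_le_pos; lra).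
  apply Rabs_le_inv in H1; unfold width; apply Rabs_le; lra.
- exfalso.
  assert (HA : forall j, (Z.abs j <= Z.of_nat N)%Z -> times w (j + k) = TA).
  { intros j Hj; unfold times; destruct excluded_middle_informative as [[i Hi]|]; [|reflexivity].
    exfalso; apply Hno; exists i; lia. }
  assert (D (phi t y) < rho); [|lra].
  replace t with (h (sseq (times w) k) + (t - h (sseq (times w) k))) by ring.
  rewrite <- flow_flow.
  apply (Hnear (fun j => times w (j + k)%Z)); [exact HA| |].
  + eexists; exact (tracks_shift x e (times w) h y k H).
  + rewrite <- (HA 0%Z), Z.add_0_l by lia; pose proof (times_pos w k).
    rewrite Rabs_pos_eq; lra.
Qed.

Lemma sseq_times_const w T a n :
  (forall k, (a <= k < a + Z.of_nat n)%Z -> times w k = T) ->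
  sseq (times w) (a + Z.of_nat n) = sseq (times w) a + INR n * T.
Proof.
induction n as [|n IH]; intros H.
- rewrite Z.add_0_r; simpl; ring.
- replace (a + Z.of_nat (S n))%Z with (a + Z.of_nat n + 1)%Z by lia.
  rewrite sseq_succ, IH, S_INR, (H (a + Z.of_nat n)%Z) by (intros; try apply H; lia); ring.
Qed.

Lemma mark_gap w i :
  sseq (times w) (center M w (i + 1)) - sseq (times w) (center M w i)
  = (INR (w i) + 1) * (IZR M * TA) + (2 * INR m + 1) * (TB - TA).
Proof.
pose proof M_large as HMl.
set (c := center M w i); set (c' := center M w (i + 1)).
assert (Hc' : c' = (c + (Z.of_nat (w i) + 1) * M)%Z) by (unfold c, c'; apply center_succ).
assert (Hgap : (M <= c' - c)%Z) by nia.
(* From c to c' there are m + 1 steps TB, then n steps TA, then m steps TB, the second half-block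
   belonging to the next mark. *)
set (n := Z.to_nat (c' - c - 2 * Z.of_nat m - 1)).
assert (Hn : Z.of_nat n = (c' - c - 2 * Z.of_nat m - 1)%Z) by (unfold n; lia).
assert (H1 : forall k, (c <= k < c + Z.of_nat (m + 1))%Z -> times w k = TB).
{ intros k Hk; unfold times; destruct excluded_middle_informative as [|H]; [reflexivity|].
  exfalso; apply H; exists i; fold c; lia. }
assert (H3 : forall k, (c' - Z.of_nat m <= k < c' - Z.of_nat m + Z.of_nat m)%Z ->
  times w k = TB).
{ intros k Hk; unfold times; destruct excluded_middle_informative as [|H]; [reflexivity|].
  exfalso; apply H; exists (i + 1)%Z; fold c'; lia. }
assert (H2 : forall k, (c + Z.of_nat (m + 1) <= k < c + Z.of_nat (m + 1) + Z.of_nat n)%Z ->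
  times w k = TA).
{ intros k Hk; unfold times; destruct excluded_middle_informative as [[j Hj]|]; [|reflexivity].
  exfalso; destruct (Z_le_gt_dec j i) as [Hji|Hji].
  - pose proof (center_gap M w j i ltac:(lia) Hji) as H; fold c in H; nia.
  - pose proof (center_gap M w (i + 1) j ltac:(lia) ltac:(lia)) as H; fold c' in H; nia. }
apply sseq_times_const in H1, H2, H3.
replace (c + Z.of_nat (m + 1) + Z.of_nat n)%Z with (c' - Z.of_nat m)%Z in H2 by lia.
replace (c' - Z.of_nat m + Z.of_nat m)%Z with c' in H3 by lia.
assert (HnR : INR n = (INR (w i) + 1) * IZR M - 2 * INR m - 1).
{ rewrite INR_IZR_INZ, Hn, !minus_IZR, mult_IZR, Hc', plus_IZR, mult_IZR, plus_IZR,
    <- !INR_IZR_INZ; ring. }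
rewrite H3, H2, H1, HnR, plus_INR; simpl; ring.
Qed.

Lemma mark_gap_bounds w i :
  (INR (w i) + 1) * (IZR M * TA) - width
  <= sseq (times w) (center M w (i + 1)) - sseq (times w) (center M w i)
  <= (INR (w i) + 1) * (IZR M * TA) + width.
Proof.
rewrite mark_gap.
assert (- width <= (2 * INR m + 1) * (TB - TA) <= width); [|lra].
unfold width; pose proof (pos_INR m); pose proof (pos_INR N); split; nra.
Qed.

Lemma M_TA : 100 * width <= IZR M * TA.
Proof. pose proof width_pos; nra. Qed.

Lemma mark_time_gap w h i : bilip h ->
  9/10 * ((INR (w i) + 1) * (IZR M * TA) - width)
  <= mark_time w h (i + 1) - mark_time w h i
  <= 11/10 * ((INR (w i) + 1) * (IZR M * TA) + width).
Proof.
intros [_ Hh]; pose proof (mark_gap_bounds w i) as H; pose proof M_TA; pose proof width_pos.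
assert (IZR M * TA <= (INR (w i) + 1) * (IZR M * TA))
  by (pose proof (pos_INR (w i)); nra).
unfold mark_time.
specialize (Hh (sseq (times w) (center M w i)) (sseq (times w) (center M w (i + 1)))
  ltac:(lra)); lra.
Qed.

(** The shortest gap is 9/10 * 99 widths, rounded down to 80. *)
Lemma mark_time_step w h i : bilip h -> 80 * width <= mark_time w h (i + 1) - mark_time w h i.
Proof.
intros Hh; pose proof (mark_time_gap w h i Hh); pose proof M_TA; pose proof width_pos.
assert (IZR M * TA <= (INR (w i) + 1) * (IZR M * TA))
  by (pose proof (pos_INR (w i)); nra).
lra.
Qed.

(** At a mark the orbit is farther than rho from the closed orbit, so each mark of one word is near
    a mark of the other; [matching] aligns them with one index offset, and comparing gaps gives the
    letters. *)
Lemma same_orbit_decode w w' h h' y s :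
  (forall i, (w i < 4)%nat) -> (forall i, (w' i < 4)%nat) ->
  tracks x e (times w) h y -> tracks x e (times w') h' (phi s y) ->
  exists j, (forall n, w n = w' (n + j)%Z) /\ Rabs (s + mark_time w' h' j) <= width.
Proof.
intros Hw Hw' Hy Hy'.
set (p := mark_time w h); set (q := fun j => s + mark_time w' h' j).
pose proof width_pos as HC.
assert (Hp : forall i, 80 * width <= p (i + 1)%Z - p i)
  by (intros i; apply mark_time_step, Hy).
assert (Hq : forall i, 80 * width <= q (i + 1)%Z - q i).
{ intros i; unfold q; pose proof (mark_time_step w' h' i (proj1 Hy')); lra. }
assert (Hpq : forall i, exists j, Rabs (p i - q j) <= width).
{ intros i; pose proof (mark_far w h y i Hy) as H.
  destruct (far_near_mark w' h' (phi s y) (p i - s) Hy') as [j Hj].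
  - rewrite flow_flow; replace (s + (p i - s)) with (p i) by ring; unfold p; lra.
  - exists j; unfold q; now replace (p i - (s + mark_time w' h' j))
      with (p i - s - mark_time w' h' j) by ring. }
assert (Hqp : forall j, exists i, Rabs (p i - q j) <= width).
{ intros j; pose proof (mark_far w' h' _ j Hy') as H; rewrite flow_flow in H.
  destruct (far_near_mark w h y (q j) Hy) as [i Hi]; [unfold q; lra|].
  exists i; now rewrite Rabs_minus_sym. }
destruct (Hpq 0%Z) as [j Hj]; exists j.
pose proof (matching p q width (80 * width) ltac:(lra) Hp Hq Hpq Hqp 0 j Hj) as Hm.
split.
- intros n.
  pose proof (Hm n) as H1; pose proof (Hm (n + 1)%Z) as H2.
  rewrite Z.add_0_l in H1, H2.
  replace (j + (n + 1))%Z with (n + j + 1)%Z in H2 by lia.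
  replace (j + n)%Z with (n + j)%Z in H1 by lia.
  apply Rabs_le_inv in H1; apply Rabs_le_inv in H2.
  pose proof (mark_time_gap w h n (proj1 Hy)) as H3.
  pose proof (mark_time_gap w' h' (n + j)%Z (proj1 Hy')) as H4.
  pose proof M_TA as HL; unfold p, q in H1, H2.
  set (L := IZR M * TA) in *; clearbody L.
  specialize (Hw n); specialize (Hw' (n + j)%Z).
  (* The distorted gaps of different letters are at least 3/10 * L >= 30 * width apart, whereas the
     total error is 4 * width: 11/10 and 9/10 from the two gap bounds and 2 from the alignment. *)
  destruct (w n) as [|[|[|[|]]]]; destruct (w' (n + j)%Z) as [|[|[|[|]]]];
    try reflexivity; try lia; exfalso; simpl in H3, H4; lra.
- unfold p in Hj; rewrite mark_time_0 in Hj by apply Hy.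
  fold (q j); rewrite <- Rabs_Ropp; now replace (- q j) with (0 - q j) by ring.
Qed.

(** * Canonical points on tracking orbits *)

(** A continuous density supported on the excursions; cutting at rho kills it wherever the orbit is
    close to the closed one. *)
Definition weight (u : X) : R := Rmax 0 (D u - rho).

Lemma weight_pos u : 0 <= weight u.
Proof. apply Rmax_l. Qed.

Lemma weight_0 u : D u < rho -> weight u = 0.
Proof. intros H; apply Rmax_left; lra. Qed.

Lemma weight_lipschitz u v : Rabs (weight u - weight v) <= d u v.
Proof.
pose proof (HD u v); pose proof (HD v u) as H1; rewrite (dist_sym v) in H1.
unfold weight, Rmax; apply Rabs_le; pose proof (dist_pos u v).
destruct (Rle_dec 0 (D u - rho)), (Rle_dec 0 (D v - rho)); lra.
Qed.

Lemma weight_continuous y t : continuous (fun t => weight (phi t y)) t.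
Proof.
apply continuity_pt_filterlim; intros eps He.
destruct (proj1 Hf t y eps He) as [del [Hdel H]]; exists del; split; [exact Hdel|].
intros s [_ Hs]; simpl in *; unfold R_dist in *.
eapply Rle_lt_trans; [apply weight_lipschitz|].
apply H; [exact Hs|]; now rewrite dist_self.
Qed.

(** The excursion at mark 0 lies within [width] of time 0 and every other one beyond 79 * width, so
    this window still isolates it after a move by [width]. *)
Definition moment (c : R -> R) (y : X) : R :=
  RInt (fun t => c t * weight (phi t y)) (- (2 * width)) (2 * width).

Lemma moment_ex c y a b : (forall t, continuous c t) ->
  ex_RInt (fun t => c t * weight (phi t y)) a b.
Proof.
intros Hc'; apply (ex_RInt_continuous (V := R_CompleteNormedModule)); intros t _.
apply (continuous_mult c (fun t => weight (phi t y))); [apply Hc'|apply weight_continuous].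
Qed.

Lemma moment_conv c K (yn : nat -> X) y :
  (forall t, continuous c t) -> (forall t, Rabs t <= 2 * width -> Rabs (c t) <= K) ->
  seq_conv d yn y -> rconv (fun n => moment c (yn n)) (moment c y).
Proof.
intros Hcc HK Hy eps He; pose proof width_pos.
assert (HK0 : 0 <= K).
{ specialize (HK 0); rewrite Rabs_R0 in HK; pose proof (Rabs_pos (c 0)); lra. }
(* The integral over a window of length 4 * width of a function bounded by K * a is then below
   eps. *)
set (a := eps / (4 * width * (K + 1) + 1)).
assert (Hden : 0 < 4 * width * (K + 1) + 1) by nra.
assert (Ha : 0 < a) by now apply Rdiv_lt_0_compat.
destruct (flow_equicontinuous (2 * width) a Ha) as [del [Hdel Heq]].
destruct (Hy del Hdel) as [n0 Hn0]; exists n0; intros n Hn; specialize (Hn0 n Hn).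
unfold moment.
change (Rabs (minus (RInt (fun t => c t * weight (phi t (yn n))) (- (2 * width)) (2 * width))
  (RInt (fun t => c t * weight (phi t y)) (- (2 * width)) (2 * width))) < eps).
rewrite <- (RInt_minus (V := R_CompleteNormedModule)) by now apply moment_ex.
eapply Rle_lt_trans.
- apply (abs_RInt_le_const _ _ _ (K * a)); [lra| |].
  + apply (ex_RInt_minus (V := R_CompleteNormedModule)); now apply moment_ex.
  + intros t Ht; assert (Rabs t <= 2 * width) as Ht' by (apply Rabs_le; lra).
    unfold minus, plus, opp; simpl.
    replace (c t * weight (phi t (yn n)) + - (c t * weight (phi t y)))
      with (c t * (weight (phi t (yn n)) - weight (phi t y))) by ring.
    rewrite Rabs_mult; apply Rmult_le_compat; [apply Rabs_pos|apply Rabs_pos|now apply HK|].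
    eapply Rle_trans; [apply weight_lipschitz|left; now apply Heq].
- assert (Hea : eps = a * (4 * width * (K + 1) + 1)) by (unfold a; field; lra).
  rewrite Hea; nra.
Qed.

Definition mass (y : X) : R := moment (fun _ => 1) y.

(* Time of the centre of mass of the excursion of y at mark 0. *)
Definition com (y : X) : R := moment (fun t => t) y / mass y.

Lemma mass_pos y : 2 * rho < D y -> 0 < mass y.
Proof.
intros Hy; pose proof width_pos.
(* The factor 2 in 2 * rho is spent here: [D] stays above rho for a short time around 0, so the
   weight is positive there. *)
destruct (flow_small_time rho Hrho) as [k0 [Hk0 Hk]].
set (k := Rmin k0 1).
assert (Hk1 : 0 < k /\ k <= k0 /\ k <= 1).
{ unfold k; pose proof (Rmin_l k0 1); pose proof (Rmin_r k0 1).
  repeat split; try lra; apply Rmin_pos; lra. }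
clearbody k.
assert (Hex : forall a b, ex_RInt (fun t => 1 * weight (phi t y)) a b).
{ intros a b; apply (moment_ex (fun _ => 1)); intros; apply continuous_const. }
unfold mass, moment.
rewrite <- (RInt_Chasles (V := R_CompleteNormedModule) _ _ (- k) _) by apply Hex.
rewrite <- (RInt_Chasles (V := R_CompleteNormedModule) _ (- k) k (2 * width)) by apply Hex.
assert (Hnn : forall a b, a <= b -> 0 <= RInt (fun t => 1 * weight (phi t y)) a b).
{ intros a b Hab; apply RInt_ge_0; [exact Hab|apply Hex|].
  intros t _; pose proof (weight_pos (phi t y)); lra. }
pose proof (Hnn (- (2 * width)) (- k) ltac:(lra)).
pose proof (Hnn k (2 * width) ltac:(lra)).
assert (0 < RInt (fun t => 1 * weight (phi t y)) (- k) k).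
{ apply RInt_gt_0; [lra| |].
  - intros t Ht; specialize (Hk t y ltac:(apply Rabs_def1; lra)).
    pose proof (HD y (phi t y)) as H2; rewrite dist_sym in H2.
    rewrite Rmult_1_l; unfold weight; eapply Rlt_le_trans; [|apply Rmax_r]; lra.
  - intros t _; apply (continuous_mult (fun _ => 1)); [apply continuous_const|].
    apply weight_continuous. }
unfold plus; simpl; lra.
Qed.

Lemma com_bound y : 2 * rho < D y -> Rabs (com y) <= 2 * width.
Proof.
intros Hy; pose proof (mass_pos y Hy) as Hm; pose proof width_pos.
assert (Hc1 : forall t, continuous (fun _ : R => 1) t) by (intros; apply continuous_const).
assert (Hct : forall t : R, continuous (fun u : R => u) t) by (intros; apply continuous_id).
assert (Hsc : forall a, a * mass y
  = RInt (fun t => scal a (1 * weight (phi t y))) (- (2 * width)) (2 * width)).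
{ intros a; rewrite (RInt_scal (V := R_CompleteNormedModule)); [reflexivity|].
  now apply (moment_ex (fun _ => 1)). }
assert (Hup : moment (fun t => t) y <= 2 * width * mass y).
{ rewrite Hsc; apply RInt_le; [lra|now apply moment_ex| |].
  - apply (ex_RInt_scal (V := R_CompleteNormedModule)); now apply (moment_ex (fun _ => 1)).
  - intros t Ht; pose proof (weight_pos (phi t y)); unfold scal; simpl; unfold mult; simpl; nra. }
assert (Hlo : - (2 * width) * mass y <= moment (fun t => t) y).
{ rewrite Hsc; apply RInt_le; [lra| |now apply moment_ex|].
  - apply (ex_RInt_scal (V := R_CompleteNormedModule)); now apply (moment_ex (fun _ => 1)).
  - intros t Ht; pose proof (weight_pos (phi t y)); unfold scal; simpl; unfold mult; simpl; nra. }
assert (Hcom : moment (fun t => t) y = com y * mass y) by (unfold com; field; lra).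
rewrite Hcom in Hup, Hlo.
apply Rmult_le_reg_r in Hup, Hlo; try exact Hm; apply Rabs_le; lra.
Qed.

Lemma com_conv yn y :
  2 * rho < D y -> seq_conv d yn y -> rconv (fun n => com (yn n)) (com y).
Proof.
intros Hy Hyn; pose proof (mass_pos y Hy).
apply is_lim_seq_Reals; unfold com.
apply is_lim_seq_div'.
- apply is_lim_seq_Reals, (moment_conv (fun t => t) (2 * width)); [|now auto|exact Hyn].
  intros; apply continuous_id.
- apply is_lim_seq_Reals, (moment_conv (fun _ => 1) 1); [| |exact Hyn].
  + intros; apply continuous_const.
  + intros; rewrite Rabs_R1; lra.
- lra.
Qed.

(* No other excursion enters the window when it is moved by at most W. *)
Lemma RInt_window (F : R -> R) W s :
  (forall t, continuous F t) -> (forall t, W < Rabs t < 3 * W -> F t = 0) ->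
  0 < W -> Rabs s <= W ->
  RInt (fun t => F (t + s)) (- (2 * W)) (2 * W) = RInt F (- (2 * W)) (2 * W).
Proof.
intros HF H0 HW Hs; apply Rabs_le_inv in Hs.
assert (Hex : forall a b, ex_RInt F a b).
{ intros a b; apply (ex_RInt_continuous (V := R_CompleteNormedModule)); intros; apply HF. }
assert (Hz : forall a b, (forall t, Rmin a b < t < Rmax a b -> W < Rabs t < 3 * W) ->
  RInt F a b = 0).
{ intros a b Hab; rewrite (RInt_ext F (fun _ => 0)).
  - rewrite RInt_const; unfold scal; simpl; unfold mult; simpl; ring.
  - intros t Ht; now apply H0, Hab. }
assert (Hlin := RInt_comp_lin (V := R_CompleteNormedModule) F 1 s (- (2 * W)) (2 * W)
  (Hex _ _)).
rewrite !Rmult_1_l in Hlin.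
transitivity (RInt F (- (2 * W) + s) (2 * W + s)).
{ rewrite <- Hlin; apply RInt_ext; intros t _.
  change (F (t + s) = 1 * F (1 * t + s)); now rewrite !Rmult_1_l. }
clear Hlin.
rewrite <- (RInt_Chasles (V := R_CompleteNormedModule) F (- (2 * W) + s) (- (2 * W)) (2 * W + s))
  by apply Hex.
rewrite <- (RInt_Chasles (V := R_CompleteNormedModule) F (- (2 * W)) (2 * W) (2 * W + s))
  by apply Hex.
rewrite (Hz (- (2 * W) + s)), (Hz (2 * W)).
- unfold plus; simpl; ring.
- intros t Ht; rewrite Rabs_pos_eq; unfold Rmin, Rmax in Ht;
    destruct (Rle_dec (2 * W) (2 * W + s)); lra.
- intros t Ht; rewrite Rabs_left; unfold Rmin, Rmax in Ht;
    destruct (Rle_dec (- (2 * W) + s) (- (2 * W))); lra.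
Qed.

Lemma mark_time_away w h i : bilip h -> i <> 0%Z -> 80 * width <= Rabs (mark_time w h i).
Proof.
intros Hh Hi; pose proof width_pos; pose proof (mark_time_0 w h Hh) as H0.
pose proof (steps_lower (mark_time w h) (80 * width)
  (fun i => mark_time_step w h i Hh)) as Hl.
destruct (Z_lt_le_dec 0 i) as [Hp|Hn].
- specialize (Hl 0%Z i ltac:(lia)).
  assert (1 <= IZR (i - 0)) by (apply IZR_le; lia).
  pose proof (Rle_abs (mark_time w h i)); nra.
- specialize (Hl i 0%Z ltac:(lia)).
  assert (1 <= IZR (0 - i)) by (apply IZR_le; lia).
  pose proof (Rle_abs (- mark_time w h i)) as H2; rewrite Rabs_Ropp in H2; nra.
Qed.

Lemma weight_window w y t :
  tracked x e (times w) y -> width < Rabs t < 3 * width -> weight (phi t y) = 0.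
Proof.
intros [h Hh] Ht; apply weight_0.
destruct (Rlt_le_dec (D (phi t y)) rho) as [|Hle]; [assumption|exfalso].
destruct (far_near_mark w h y t Hh Hle) as [i Hi].
destruct (Z.eq_dec i 0) as [->|Hn].
- rewrite mark_time_0, Rminus_0_r in Hi by apply Hh; lra.
- pose proof (mark_time_away w h i (proj1 Hh) Hn).
  pose proof (Rabs_triang_inv (mark_time w h i) t) as H1.
  rewrite Rabs_minus_sym in H1; pose proof width_pos; lra.
Qed.

Lemma tracked_far w y : tracked x e (times w) y -> 2 * rho < D y.
Proof.
intros [h Hh]; pose proof (mark_far w h y 0 Hh) as H.
rewrite mark_time_0, flow_0 in H by apply Hh; exact H.
Qed.

(** Flowing by s translates the excursion by -s inside the window: the mass is unchanged and the
    first moment drops by s times the mass. *)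
Lemma com_flow w y s :
  tracked x e (times w) y -> Rabs s <= width -> com (phi s y) = com y - s.
Proof.
intros Hy Hs; pose proof (mass_pos y (tracked_far w y Hy)) as Hm; pose proof width_pos.
assert (Hwin : forall c : R -> R, (forall t, continuous c t) ->
  RInt (fun t => c (t + s) * weight (phi (t + s) y)) (- (2 * width)) (2 * width) = moment c y).
{ intros c Hcc.
  apply (RInt_window (fun t => c t * weight (phi t y))); [| |lra|exact Hs].
  - intros t; apply (continuous_mult c (fun t => weight (phi t y))); [apply Hcc|].
    apply weight_continuous.
  - intros t Ht; rewrite (weight_window w y t Hy Ht); ring. }
assert (Hcs : forall t : R, continuous (fun u : R => u + - s) t).
{ intros t; apply (continuous_plus (fun t : R => t) (fun _ => - s));
    [apply continuous_id|apply continuous_const]. }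
assert (Hc1 : forall t, continuous (fun _ : R => 1) t) by (intros; apply continuous_const).
assert (Hct : forall t : R, continuous (fun u : R => u) t) by (intros; apply continuous_id).
assert (Hmass : mass (phi s y) = mass y).
{ unfold mass; rewrite <- (Hwin (fun _ => 1) Hc1); apply RInt_ext; intros t _.
  now rewrite flow_flow, (Rplus_comm s). }
assert (Hmom : moment (fun t => t) (phi s y) = moment (fun t => t + - s) y).
{ rewrite <- (Hwin (fun t => t + - s) Hcs); apply RInt_ext; intros t _.
  rewrite flow_flow, (Rplus_comm s), Rplus_assoc, Rplus_opp_r, Rplus_0_r; reflexivity. }
assert (Hsplit : moment (fun t => t + - s) y = moment (fun t => t) y - s * mass y).
{ unfold moment at 1.
  rewrite (RInt_ext _ (fun t => plus (t * weight (phi t y))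
    (scal (- s) (1 * weight (phi t y))))).
  - rewrite (RInt_plus (V := R_CompleteNormedModule)).
    + rewrite (RInt_scal (V := R_CompleteNormedModule)).
      * unfold plus, scal; simpl; unfold mult; simpl; unfold mass, moment; ring.
      * now apply (moment_ex (fun _ => 1)).
    + now apply (moment_ex (fun t => t)).
    + apply (ex_RInt_scal (V := R_CompleteNormedModule)); now apply (moment_ex (fun _ => 1)).
  - intros t _; unfold plus, scal; simpl; unfold mult; simpl; ring. }
unfold com; rewrite Hmom, Hmass, Hsplit; field; lra.
Qed.

Lemma canonical_flow w y s :
  tracked x e (times w) y -> Rabs s <= width ->
  phi (com (phi s y)) (phi s y) = phi (com y) y.
Proof. intros Hy Hs; rewrite (com_flow w y s Hy Hs), flow_flow; f_equal; ring. Qed.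

(** * The conjugacy *)

Context (Sig : (Z -> nat) -> Prop).
Hypothesis Hsub : subshift 4 Sig.
Hypothesis Haper : forall w p, Sig w -> (forall i, w (i + p)%Z = w i) -> p = 0%Z.

Lemma Sig_shift w : Sig w -> Sig (shift w).
Proof. apply (proj2 (proj2 Hsub) w). Qed.

Lemma Sig_shiftn w j : Sig w -> Sig (shiftn j w).
Proof.
intros Hw; revert j; apply Z.peano_ind.
- replace (shiftn 0 w) with w; [exact Hw|].
  apply functional_extensionality; intros i; unfold shiftn; now rewrite Z.add_0_r.
- intros j Hj; replace (shiftn (Z.succ j) w) with (shift (shiftn j w)).
  + now apply Sig_shift.
  + apply functional_extensionality; intros i; unfold shift, shiftn; f_equal; lia.
- intros j Hj; apply (proj2 (proj2 Hsub) (shiftn (Z.pred j) w)).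
  replace (shift (shiftn (Z.pred j) w)) with (shiftn j w); [exact Hj|].
  apply functional_extensionality; intros i; unfold shift, shiftn; f_equal; lia.
Qed.

Lemma shift_shiftn j w : shift (shiftn j w) = shiftn (j + 1) w.
Proof. apply functional_extensionality; intros i; unfold shift, shiftn; f_equal; lia. Qed.

Definition seq_tends (wn : nat -> Z -> nat) (w : Z -> nat) :=
  forall i, exists n0, forall n, (n0 <= n)%nat -> wn n i = w i.

Lemma seq_tends_agree wn w K :
  seq_tends wn w -> exists n0, forall n, (n0 <= n)%nat -> agree_on K (wn n) w.
Proof.
intros H; induction K as [|K [n0 IH]].
- destruct (H 0%Z) as [n0 H0]; exists n0; intros n Hn i Hi.
  replace i with 0%Z by lia; now apply H0.
- destruct (H (Z.of_nat (S K))) as [n1 H1]; destruct (H (- Z.of_nat (S K))%Z) as [n2 H2].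
  exists (n0 + n1 + n2)%nat; intros n Hn i Hi.
  destruct (Z.eq_dec i (Z.of_nat (S K))) as [->|]; [apply H1; lia|].
  destruct (Z.eq_dec i (- Z.of_nat (S K))) as [->|]; [apply H2; lia|].
  apply (IH n); lia.
Qed.

Lemma seq_tends_sub wn w g : seq_tends wn w -> incr g -> seq_tends (fun n => wn (g n)) w.
Proof.
intros H Hg i; destruct (H i) as [n0 H0]; exists n0; intros n Hn; apply H0.
pose proof (incr_ge g Hg n); lia.
Qed.

Lemma times_tends wn w :
  seq_tends wn w ->
  forall i, exists n0, forall n, (n0 <= n)%nat -> times (wn n) i = times w i.
Proof.
intros H i; destruct (seq_tends_agree wn w (Z.to_nat (Z.abs i) + m) H) as [n0 H0].
exists n0; intros n Hn; apply (times_agree _ _ _ _ (H0 n Hn)); lia.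
Qed.

(** Compactness of the subshift, obtained from the diagonal lemma by viewing letters as bounded
    reals; a convergent sequence of integers is eventually constant. *)
Lemma sequence_subsequence (wn : nat -> Z -> nat) :
  (forall n, Sig (wn n)) -> exists g w, incr g /\ Sig w /\ seq_tends (fun n => wn (g n)) w.
Proof.
intros Hw.
set (dec := fun k => let (a, b) := Cantor.of_nat k in (Z.of_nat a - Z.of_nat b)%Z).
assert (Hdec : forall i, exists k, dec k = i).
{ intros i; exists (Cantor.to_nat (Z.to_nat i, Z.to_nat (- i))); unfold dec.
  rewrite Cantor.cancel_of_to; lia. }
destruct (diagonal_subsequence (fun n k => INR (wn n (dec k))) (fun _ => 4)) as [g [Hg H]].
{ intros n k; rewrite Rabs_pos_eq by apply pos_INR.
  replace 4 with (INR 4) by (simpl; ring); apply le_INR.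
  pose proof (proj1 Hsub _ (Hw n) (dec k)); lia. }
assert (Hlim : forall i, exists a, exists n0, forall n, (n0 <= n)%nat -> wn (g n) i = a).
{ intros i; destruct (Hdec i) as [k <-]; destruct (H k) as [l Hl].
  destruct (Hl (1/2) ltac:(lra)) as [n0 H0]; exists (wn (g n0) (dec k)), n0; intros n Hn.
  pose proof (H0 n Hn) as H1; pose proof (H0 n0 (le_n _)) as H2.
  apply Rabs_def2 in H1; apply Rabs_def2 in H2.
  assert (INR (wn (g n) (dec k)) < INR (S (wn (g n0) (dec k)))) as H3 by (rewrite S_INR; lra).
  assert (INR (wn (g n0) (dec k)) < INR (S (wn (g n) (dec k)))) as H4 by (rewrite S_INR; lra).
  apply INR_lt in H3, H4; lia. }
apply choice in Hlim; destruct Hlim as [w Hwl].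
exists g, w; split; [exact Hg|]; split; [|exact Hwl].
apply (proj1 (proj2 Hsub)).
- intros i; destruct (Hwl i) as [n0 H0]; rewrite <- (H0 n0 (le_n _)).
  apply (proj1 Hsub), Hw.
- intros K; destruct (seq_tends_agree (fun n => wn (g n)) w K Hwl) as [n0 H0].
  exists (wn (g n0)); split; [apply Hw|].
  intros i Hi; symmetry; apply (H0 n0 (le_n _)); exact Hi.
Qed.

(** Here aperiodicity enters: the offset found by decoding is a period of w, hence 0, and mark 0 is
    at time 0. *)
Lemma self_decode w h y s :
  Sig w -> tracks x e (times w) h y -> tracked x e (times w) (phi s y) -> Rabs s <= width.
Proof.
intros Hw Hy [h' Hy'].
destruct (same_orbit_decode w w h h' y s) as [j [Hj Hs]]; try apply Hsub; auto.
rewrite (Haper w j Hw) in Hs; [|intros i; now rewrite <- Hj].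
now rewrite mark_time_0, Rplus_0_r in Hs by apply Hy'.
Qed.

(** The chosen value does not depend on the tracking point: two of them differ by a time at most
    [width], which the centre of mass compensates ([base_spec]). *)
Definition base (w : Z -> nat) : X :=
  epsilon (inhabits x) (fun u => exists y, tracked x e (times w) y /\ u = phi (com y) y).

Lemma base_spec w y : Sig w -> tracked x e (times w) y -> base w = phi (com y) y.
Proof.
intros Hw Hy; unfold base.
set (P := fun u => exists y, tracked x e (times w) y /\ u = phi (com y) y).
assert (HP : P (epsilon (inhabits x) P)) by (apply epsilon_spec; now exists (phi (com y) y), y).
destruct HP as [y' [Hy' ->]].
destruct (Hunique (times w) (times_valid w) y' y Hy' Hy) as [s ->].
apply (canonical_flow w y s Hy).
destruct Hy as [h Hh]; exact (self_decode w h y s Hw Hh Hy').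
Qed.

Lemma base_tracked w : Sig w -> exists y, tracked x e (times w) y /\ base w = phi (com y) y.
Proof.
intros Hw; destruct (Hexists (times w) (times_valid w)) as [y Hy].
exists y; split; [exact Hy|now apply base_spec].
Qed.

(** Were s a nonzero period of y, every [phi (n * s) y] would track w, although tracking times are
    bounded by [width]. *)
Lemma base_inj_time w a b : Sig w -> phi a (base w) = phi b (base w) -> a = b.
Proof.
intros Hw; destruct (base_tracked w Hw) as [y [Hy ->]].
rewrite !flow_flow; intros Hab.
set (s := b - a).
assert (Hs : phi s y = y).
{ apply (f_equal (phi (- (com y + a)))) in Hab; rewrite !flow_flow in Hab.
  replace (com y + a + - (com y + a)) with 0 in Hab by ring; rewrite flow_0 in Hab.
  replace (com y + b + - (com y + a)) with s in Hab by (unfold s; ring); now symmetry. }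
assert (Hns : forall n, phi (INR n * s) y = y).
{ induction n as [|n IH]; [rewrite Rmult_0_l; apply flow_0|].
  rewrite S_INR, Rmult_plus_distr_r, Rmult_1_l, <- flow_flow, IH; exact Hs. }
destruct (Req_dec s 0) as [|Hn]; [unfold s in *; lra|exfalso].
destruct (INR_unbounded (width / Rabs s)) as [n Hnb].
pose proof (Rabs_pos_lt s Hn) as Hsp.
apply (Rmult_lt_compat_r (Rabs s)) in Hnb; [|exact Hsp].
replace (width / Rabs s * Rabs s) with width in Hnb by (field; lra).
destruct Hy as [h Hh].
assert (Rabs (INR n * s) <= width).
{ apply (self_decode w h y _ Hw Hh); rewrite Hns; now exists h. }
rewrite Rabs_mult, (Rabs_pos_eq (INR n)) in * by apply pos_INR; lra.
Qed.

(** The point at mark 1 tracks the shifted word. Both centres of mass are at most 2 * width, whence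
    76 = 80 - 4 below and the extra 4 * width above. *)
Lemma base_shift w : Sig w ->
  exists r, base (shift w) = phi r (base w) /\
    76 * width <= r <= 11/10 * (4 * (IZR M * TA) + width) + 4 * width.
Proof.
intros Hw; destruct (base_tracked w Hw) as [y [[h Hy] ->]].
destruct (tracks_mark w h y 1 Hy) as [h' [Hy' _]].
set (p := mark_time w h 1) in *.
exists (p + com (phi p y) - com y); split.
- rewrite (base_spec (shift w) (phi p y)).
  + rewrite !flow_flow; f_equal; ring.
  + now apply Sig_shift.
  + now exists h'.
- assert (H1 := com_bound y (tracked_far w y (ex_intro _ h Hy))).
  assert (H2 := com_bound _ (tracked_far _ _ (ex_intro _ h' Hy'))).
  apply Rabs_le_inv in H1; apply Rabs_le_inv in H2.
  pose proof (mark_time_step w h 0 (proj1 Hy)) as H3.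
  pose proof (mark_time_gap w h 0 (proj1 Hy)) as H4.
  rewrite (mark_time_0 w h (proj1 Hy)), Rminus_0_r in H3, H4.
  change (0 + 1)%Z with 1%Z in H3, H4; fold p in H3, H4.
  assert (H5 : INR (w 0%Z) + 1 <= 4).
  { pose proof (proj1 Hsub w Hw 0%Z) as Hlt.
    assert (INR (w 0%Z) <= INR 3) by (apply le_INR; lia).
    simpl in *; lra. }
  pose proof M_TA; pose proof width_pos.
  assert ((INR (w 0%Z) + 1) * (IZR M * TA) <= 4 * (IZR M * TA))
    by (apply Rmult_le_compat_r; lra).
  lra.
Qed.

Definition ret (w : Z -> nat) : R :=
  epsilon (inhabits 0) (fun r => base (shift w) = phi r (base w)).

Lemma ret_spec w : Sig w -> base (shift w) = phi (ret w) (base w).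
Proof.
intros Hw; unfold ret; apply epsilon_spec.
destruct (base_shift w Hw) as [r [Hr _]]; now exists r.
Qed.

Definition ret_max : R := 11/10 * (4 * (IZR M * TA) + width) + 4 * width.

Lemma ret_bounds w : Sig w -> 76 * width <= ret w <= ret_max.
Proof.
intros Hw; destruct (base_shift w Hw) as [r [Hr Hb]].
replace (ret w) with r; [exact Hb|].
apply (base_inj_time w _ _ Hw); now rewrite <- Hr, <- ret_spec.
Qed.

(** Tracking points for a subsequence accumulate at a point tracking w; the centre of mass is
    continuous there and [base_spec] identifies the limit. *)
Lemma base_conv wn w :
  (forall n, Sig (wn n)) -> Sig w -> seq_tends wn w ->
  seq_conv d (fun n => base (wn n)) (base w).
Proof.
intros Hwn Hw Ht; apply NNPP; intros Hno.
assert (H : exists eps, 0 < eps /\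
  forall n0, exists n, (n0 <= n)%nat /\ eps <= d (base (wn n)) (base w)).
{ apply NNPP; intros Hq; apply Hno; intros eps He; apply NNPP; intros Hn; apply Hq.
  exists eps; split; [exact He|]; intros n0; apply NNPP; intros Hn'; apply Hn.
  exists n0; intros n Hle.
  destruct (Rlt_le_dec (d (base (wn n)) (base w)) eps) as [|Hge]; [assumption|].
  exfalso; apply Hn'; now exists n. }
destruct H as [eps [He H]].
destruct (incr_extract (fun _ n => eps <= d (base (wn n)) (base w))) as [g [Hg Hge]].
{ intros _; exact H. }
assert (Hy : forall n, exists y, tracked x e (times (wn (g n))) y /\
  base (wn (g n)) = phi (com y) y) by (intros n; now apply base_tracked).
apply choice in Hy; destruct Hy as [y Hy].
destruct (tracked_subsequence x e (fun n => times (wn (g n))) (times w) y)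
  as [g' [l [Hg' [Hl Htl]]]].
{ exact (times_tends _ _ (seq_tends_sub wn w g Ht Hg)). }
{ intros n; apply Hy. }
pose proof (flow_conv _ _ _ _ (com_conv _ _ (tracked_far w l Htl) Hl) Hl) as Hb.
rewrite <- (base_spec w l Hw Htl) in Hb.
destruct (Hb eps He) as [n0 Hn0]; specialize (Hn0 n0 (le_n _)); simpl in Hn0.
rewrite <- (proj2 (Hy (g' n0))) in Hn0.
specialize (Hge (g' n0)); simpl in Hge; lra.
Qed.

Lemma shift_tends wn w : seq_tends wn w -> seq_tends (fun n => shift (wn n)) (shift w).
Proof. intros H i; apply (H (i + 1)%Z). Qed.

Lemma agree_tends wn w : (forall n, agree_on n w (wn n)) -> seq_tends wn w.
Proof.
intros H i; exists (Z.to_nat (Z.abs i)); intros n Hn; symmetry; apply (H n); lia.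
Qed.

(** Continuity: return times are bounded, and any limit of them carries [base w] to
    [base (shift w)], so it equals [ret w] by injectivity in time. *)
Lemma ret_roof : roof Sig ret.
Proof.
split.
- intros w Hw; pose proof (ret_bounds w Hw); pose proof width_pos; lra.
- intros w eps Hw He; apply NNPP; intros Hno.
  assert (H : forall n, exists w', Sig w' /\ agree_on n w w' /\ eps <= Rabs (ret w' - ret w)).
  { intros n; apply NNPP; intros Hq; apply Hno; exists n; intros w' Hw' Hag.
    destruct (Rlt_le_dec (Rabs (ret w' - ret w)) eps) as [|Hge]; [assumption|].
    exfalso; apply Hq; now exists w'. }
  apply choice in H; destruct H as [wn Hwn].
  assert (Ht : seq_tends wn w) by (apply agree_tends; intros n; apply Hwn).
  destruct (bounded_subsequence (fun n => ret (wn n)) ret_max) as [g [r [Hg Hr]]].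
  { intros n; pose proof (ret_bounds (wn n) (proj1 (Hwn n))); pose proof width_pos.
    rewrite Rabs_pos_eq; lra. }
  assert (Hb : seq_conv d (fun n => base (wn (g n))) (base w)).
  { apply base_conv; [intros n; apply Hwn|exact Hw|now apply seq_tends_sub]. }
  assert (Hbs : seq_conv d (fun n => base (shift (wn (g n)))) (base (shift w))).
  { apply (base_conv (fun n => shift (wn (g n)))).
    - intros n; apply Sig_shift, Hwn.
    - now apply Sig_shift.
    - apply (shift_tends (fun n => wn (g n))); now apply seq_tends_sub. }
  assert (Hrw : r = ret w).
  { apply (base_inj_time w _ _ Hw); rewrite <- ret_spec by exact Hw.
    pose proof (flow_conv _ _ _ _ Hr Hb) as Hc1.
    apply (conv_unique _ _ _ Hc1).
    intros a Ha; destruct (Hbs a Ha) as [n0 H0]; exists n0; intros n Hn.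
    rewrite <- ret_spec by apply Hwn; now apply H0. }
  destruct (Hr eps He) as [n0 H0]; specialize (H0 n0 (le_n _)); simpl in H0.
  rewrite Hrw in H0; destruct (Hwn (g n0)) as [_ [_ H1]]; lra.
Qed.

Definition ret_sum (w : Z -> nat) (j : Z) : R := sseq (fun k => ret (shiftn k w)) j.

Lemma base_shiftn w j : Sig w -> base (shiftn j w) = phi (ret_sum w j) (base w).
Proof.
intros Hw; revert j.
assert (Hstep : forall j, base (shiftn (j + 1) w) = phi (ret (shiftn j w)) (base (shiftn j w))).
{ intros j; rewrite <- shift_shiftn; apply ret_spec; now apply Sig_shiftn. }
apply Z.peano_ind.
- replace (shiftn 0 w) with w.
  + unfold ret_sum; now rewrite sseq_0, flow_0.
  + apply functional_extensionality; intros i; unfold shiftn; now rewrite Z.add_0_r.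
- intros j IH; rewrite <- Z.add_1_r, Hstep, IH, flow_flow.
  unfold ret_sum; now rewrite sseq_succ.
- intros j IH; specialize (Hstep (Z.pred j)).
  pose proof (sseq_succ (fun k => ret (shiftn k w)) (Z.pred j)) as Hs.
  replace (Z.pred j + 1)%Z with j in Hstep, Hs by lia.
  rewrite IH in Hstep; symmetry in Hstep; apply flow_cancel in Hstep.
  rewrite Hstep, flow_flow; unfold ret_sum; f_equal; lra.
Qed.

Lemma shiftn_related w j t : Sig w ->
  clos_refl_sym_trans _ (susp_step Sig ret) (w, t) (shiftn j w, t - ret_sum w j).
Proof.
intros Hw; revert j.
assert (Hstep : forall j, clos_refl_sym_trans _ (susp_step Sig ret)
  (shiftn j w, t - ret_sum w j) (shiftn (j + 1) w, t - ret_sum w (j + 1))).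
{ intros j; apply rst_step; split; simpl; [now apply Sig_shiftn|].
  rewrite shift_shiftn; unfold ret_sum; rewrite sseq_succ; f_equal; ring. }
apply Z.peano_ind.
- replace (shiftn 0 w) with w.
  + unfold ret_sum; rewrite sseq_0, Rminus_0_r; apply rst_refl.
  + apply functional_extensionality; intros i; unfold shiftn; now rewrite Z.add_0_r.
- intros j IH; rewrite <- Z.add_1_r; eapply rst_trans; [exact IH|apply Hstep].
- intros j IH; specialize (Hstep (Z.pred j)).
  replace (Z.pred j + 1)%Z with j in Hstep by lia.
  eapply rst_trans; [exact IH|apply rst_sym, Hstep].
Qed.

Definition image (u : X) : Prop := exists w t, Sig w /\ phi t (base w) = u.

Lemma image_closed : closed_in d image.
Proof.
intros u l Hu Hl.
assert (H : forall n, exists q : (Z -> nat) * R, Sig (fst q) /\ 0 <= snd q <= ret_max /\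
  phi (snd q) (base (fst q)) = u n).
{ intros n; destruct (Hu n) as [w [t [Hw Ht]]].
  pose proof width_pos.
  (* Each image point is rewritten with a time between 0 and its return time, so that words and
     times both range over compact sets. *)
  destruct (steps_locate (ret_sum w) (76 * width) ltac:(lra)) with (t := t) as [i Hi].
  { intros i; unfold ret_sum; rewrite sseq_succ.
    pose proof (ret_bounds _ (Sig_shiftn w i Hw)); lra. }
  exists (shiftn i w, t - ret_sum w i); simpl; split; [now apply Sig_shiftn|]; split.
  - unfold ret_sum in *; rewrite sseq_succ in Hi.
    pose proof (ret_bounds _ (Sig_shiftn w i Hw)); lra.
  - rewrite base_shiftn, flow_flow, <- Ht by exact Hw; f_equal; ring. }
apply choice in H; destruct H as [q Hq].
destruct (sequence_subsequence (fun n => fst (q n))) as [g [w [Hg [Hw Ht]]]].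
{ intros n; apply Hq. }
destruct (bounded_subsequence (fun n => snd (q (g n))) ret_max) as [g' [s [Hg' Hs]]].
{ intros n; destruct (Hq (g n)) as [_ [H _]]; rewrite Rabs_pos_eq; lra. }
exists w, s; split; [exact Hw|].
assert (Hb : seq_conv d (fun n => base (fst (q (g (g' n))))) (base w)).
{ apply (base_conv (fun n => fst (q (g (g' n))))); [intros n; apply Hq|exact Hw|].
  exact (seq_tends_sub _ w g' Ht Hg'). }
apply (conv_unique _ _ _ (flow_conv _ _ _ _ Hs Hb)).
intros eps He; destruct (conv_sub u l _ Hl (incr_comp g g' Hg Hg') eps He) as [n0 H0].
exists n0; intros n Hn; rewrite (proj2 (proj2 (Hq (g (g' n))))); now apply H0.
Qed.

Lemma image_conj_suspension :
  conj_suspension d phi image Sig ret (fun w t => phi t (base w)).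
Proof.
split; [|split; [|split; [|split]]].
- intros w t Hw; now exists w, t.
- intros u Hu; exact Hu.
- intros w t eps Hw He; apply NNPP; intros Hno.
  assert (H : forall n, exists q : (Z -> nat) * R, Sig (fst q) /\ agree_on n w (fst q) /\
    Rabs (snd q - t) < / INR (S n) /\
    eps <= d (phi t (base w)) (phi (snd q) (base (fst q)))).
  { intros n; apply NNPP; intros Hq; apply Hno; exists n, (/ INR (S n)).
    split; [apply inv_S_pos|]; intros w' t' Hw' Hag Ht'.
    destruct (Rlt_le_dec (d (phi t (base w)) (phi t' (base w'))) eps) as [|Hge];
      [assumption|].
    exfalso; apply Hq; now exists (w', t'). }
  apply choice in H; destruct H as [q Hq].
  assert (Hb : seq_conv d (fun n => base (fst (q n))) (base w)).
  { apply (base_conv (fun n => fst (q n))); [intros n; apply Hq|exact Hw|].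
    apply agree_tends; intros n; apply Hq. }
  assert (Ht : rconv (fun n => snd (q n)) t).
  { intros a Ha; destruct (inv_S_small a Ha) as [n0 H0]; exists n0; intros n Hn.
    eapply Rlt_trans; [apply Hq|now apply H0]. }
  destruct (flow_conv _ _ _ _ Ht Hb eps He) as [n0 H0]; specialize (H0 n0 (le_n _)).
  rewrite dist_sym in H0; destruct (Hq n0) as [_ [_ [_ H1]]]; lra.
- intros w t s _; symmetry; apply flow_flow.
- intros w t w' t' Hw Hw'; split.
  + intros Heq.
    destruct (base_tracked w Hw) as [y [[h Hy] Hby]].
    destruct (base_tracked w' Hw') as [y' [[h' Hy'] Hby']].
    (* Equal images put both tracking points on one orbit. Decoding gives w as a shift of w', and
       injectivity in time then fixes the difference of the times as a sum of returns. *)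
    assert (Hyy : y' = phi (com y + t - (com y' + t')) y).
    { rewrite Hby, Hby', !flow_flow in Heq; symmetry in Heq; apply flow_cancel in Heq.
      etransitivity; [exact Heq|]; rewrite flow_flow; f_equal; ring. }
    rewrite Hyy in Hy'.
    destruct (same_orbit_decode w w' h h' y _ (proj1 Hsub w Hw) (proj1 Hsub w' Hw') Hy Hy')
      as [j [Hj _]].
    assert (Hwj : w = shiftn j w').
    { apply functional_extensionality; intros n; apply Hj. }
    rewrite Hwj, base_shiftn, flow_flow in Heq by exact Hw'.
    apply (base_inj_time w' _ _ Hw') in Heq.
    apply rst_sym; rewrite Hwj.
    replace t with (t' - ret_sum w' j) by lra.
    now apply shiftn_related.
  + intros Hr.
    assert (Hgen : forall p q, clos_refl_sym_trans _ (susp_step Sig ret) p q ->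
      phi (snd p) (base (fst p)) = phi (snd q) (base (fst q))).
    { intros p q Hpq; induction Hpq as [p q [Hp ->]| | |]; simpl; try congruence.
      rewrite ret_spec by exact Hp; rewrite flow_flow; f_equal; ring. }
    exact (Hgen _ _ Hr).
Qed.

Lemma image_invariant t u : image u -> image (phi t u).
Proof. intros [w [s [Hw <-]]]; exists w, (s + t); split; [exact Hw|now rewrite flow_flow]. Qed.

End Coding.

Lemma aperiodic_subshift_conjugacy x Sig :
  nonwandering d phi x -> ~ periodic phi x ->
  strongly_shadowable d phi x -> uniformly_expansive d phi x ->
  subshift 4 Sig -> (forall w p, Sig w -> (forall i, w (i + p)%Z = w i) -> p = 0%Z) ->
  exists Y r H, closed_in d Y /\ (forall t y, Y y -> Y (phi t y)) /\
    roof Sig r /\ conj_suspension d phi Y Sig r H.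
Proof.
intros Hnw Hper Hsh Hexp Hsub Haper.
destruct (marked_excursions x Hnw Hper Hsh Hexp)
  as [e [TA [TB [D [m [N [rho [[HTA [HTB Hrho]] [HD [Hex [Hun [Hnear Hfar]]]]]]]]]]]].
set (M := up (100 * width TA TB m N)).
assert (HM : 100 * width TA TB m N <= IZR M) by (left; apply archimed).
exists (image x e TA TB D m N rho M Sig), (ret x e TA TB D m N rho M),
  (fun w t => phi t (base x e TA TB D m N rho M w)).
split; [|split; [|split]].
- eapply image_closed; eassumption.
- apply image_invariant.
- eapply ret_roof; eassumption.
- eapply image_conj_suspension; eassumption.
Qed.

End Flow.

(** * An aperiodic subshift of positive entropy *)

Definition slope : R := sqrt 2 - 1.

Lemma slope_bounds : 0 < slope < 1.
Proof.
unfold slope; pose proof (sqrt_sqrt 2 ltac:(lra)); pose proof (sqrt_pos 2); split; nra.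
Qed.

(** Infinite descent for sqrt 2: a = 2c turns a solution (a, b) into (b, c), with |c| < |b| unless b
    = 0. *)
Lemma double_square_descent (n : nat) : forall a b : Z,
  (Z.abs b < Z.of_nat n)%Z -> (a * a = 2 * (b * b))%Z -> b = 0%Z.
Proof.
induction n as [|n IH]; intros a b Hb Hab; [lia|].
destruct (Z.eq_dec b 0) as [|Hb0]; [assumption|exfalso].
destruct (Z.Even_or_Odd a) as [[c ->]|[c ->]]; [|lia].
assert (Hc : c = 0%Z) by (apply (IH b c); nia).
subst c; nia.
Qed.

(** An equality would give (s + p)^2 = 2 p^2. *)
Lemma slope_irrational p s : p <> 0%Z -> IZR s <> IZR p * slope.
Proof.
intros Hp Hs; apply Hp.
apply (double_square_descent (S (Z.abs_nat p)) (s + p)%Z); [lia|].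
apply eq_IZR; rewrite !mult_IZR, plus_IZR, Hs; unfold slope.
replace (IZR p * (sqrt 2 - 1) + IZR p) with (IZR p * sqrt 2) by ring.
replace (IZR p * sqrt 2 * (IZR p * sqrt 2)) with (IZR p * IZR p * (sqrt 2 * sqrt 2)) by ring.
rewrite sqrt_sqrt by lra; ring.
Qed.

Definition parity (a : nat) : R := INR (a mod 2).

(* The parities form a sequence of discrepancy at most 1 with respect to an
   irrational frequency, which excludes periods; the high bit is free, which
   gives entropy at least ln 2. *)
Definition balanced (w : Z -> nat) : Prop :=
  (forall i, (w i < 4)%nat) /\
  forall i j, Rabs (sseq (fun k => parity (w k)) j - sseq (fun k => parity (w k)) i
    - IZR (j - i) * slope) <= 1.

(** For fixed i and j the discrepancy bound reads finitely many letters, so it is closed; shifting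
    only changes the origin of the partial sums. *)
Lemma balanced_subshift : subshift 4 balanced.
Proof.
split; [|split].
- intros w Hw; apply Hw.
- intros w Hw4 Hw; split; [exact Hw4|]; intros i j.
  apply choice in Hw; destruct Hw as [wn Hwn].
  assert (Hev : forall i, exists n0, forall n, (n0 <= n)%nat ->
    parity (wn n i) = parity (w i)).
  { intros k; exists (Z.to_nat (Z.abs k)); intros n Hn; f_equal; symmetry.
    apply Hwn; lia. }
  pose proof (sseq_eventually (fun n k => parity (wn n k)) (fun k => parity (w k)) Hev) as Hs.
  destruct (Hs i) as [n1 H1]; destruct (Hs j) as [n2 H2].
  rewrite <- (H1 (n1 + n2)%nat), <- (H2 (n1 + n2)%nat) by lia; apply Hwn.
- assert (Hs : forall w i, sseq (fun k => parity (shift w k)) i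
    = sseq (fun k => parity (w k)) (i + 1) - sseq (fun k => parity (w k)) 1).
  { intros w i; apply (sseq_shift (fun k => parity (w k)) 1 i). }
  intros w; split; intros [H4 H]; split.
  + intros i; apply H4.
  + intros i j; rewrite !Hs; specialize (H (i + 1)%Z (j + 1)%Z).
    replace (j + 1 - (i + 1))%Z with (j - i)%Z in H by lia.
    match goal with |- Rabs ?a <= 1 => match type of H with Rabs ?b <= 1 =>
      replace a with b by ring end end; exact H.
  + intros i; specialize (H4 (i - 1)%Z); unfold shift in H4.
    now replace (i - 1 + 1)%Z with i in H4 by lia.
  + intros i j; specialize (H (i - 1)%Z (j - 1)%Z); rewrite !Hs in H.
    replace (j - 1 - (i - 1))%Z with (j - i)%Z in H by lia.
    replace (i - 1 + 1)%Z with i in H by lia; replace (j - 1 + 1)%Z with j in H by lia.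
    match goal with |- Rabs ?a <= 1 => match type of H with Rabs ?b <= 1 =>
      replace a with b by ring end end; exact H.
Qed.

(** Over n periods the discrepancy is n |S p - p * slope|. As S p is an integer and the slope
    irrational, this is unbounded if p is nonzero. *)
Lemma balanced_aperiodic w p :
  balanced w -> (forall i, w (i + p)%Z = w i) -> p = 0%Z.
Proof.
intros [_ Hw] Hp; apply NNPP; intros Hp0.
set (S := sseq (fun k => parity (w k))).
assert (HS : forall i, S (i + p)%Z = S i + S p).
{ intros i; pose proof (sseq_shift (fun k => parity (w k)) p i) as H; fold S in H.
  assert (H1 : sseq (fun k => parity (w (k + p)%Z)) i = S i); [|lra].
  apply sseq_unique; [reflexivity|]; intros k; rewrite sseq_succ; now rewrite Hp. }
assert (Hn : forall n, S (Z.of_nat n * p)%Z = INR n * S p).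
{ induction n as [|n IH]; [simpl; unfold S; rewrite sseq_0; ring|].
  replace (Z.of_nat (Datatypes.S n) * p)%Z with (Z.of_nat n * p + p)%Z by lia.
  rewrite HS, IH, S_INR; ring. }
assert (Hz : exists s, S p = IZR s).
{ destruct (sseq_IZR (fun k => Z.of_nat (w k mod 2)) p) as [s Hs]; exists s; rewrite <- Hs.
  apply sseq_unique; [reflexivity|]; intros k; unfold S; rewrite sseq_succ.
  unfold parity; now rewrite INR_IZR_INZ. }
destruct Hz as [s Hs].
assert (Hd : 0 < Rabs (IZR s - IZR p * slope)).
{ apply Rabs_pos_lt; pose proof (slope_irrational p s Hp0); lra. }
destruct (INR_unbounded (/ Rabs (IZR s - IZR p * slope))) as [n Hnb].
apply (Rmult_lt_compat_r _ _ _ Hd) in Hnb; rewrite Rinv_l in Hnb by lra.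
specialize (Hw 0%Z (Z.of_nat n * p)%Z); fold S in Hw.
rewrite Hn, Hs, Z.sub_0_r, mult_IZR, <- INR_IZR_INZ in Hw.
replace (S 0%Z) with 0 in Hw by reflexivity.
replace (INR n * IZR s - 0 - INR n * IZR p * slope)
  with (INR n * (IZR s - IZR p * slope)) in Hw by ring.
rewrite Rabs_mult, (Rabs_pos_eq (INR n)) in Hw by apply pos_INR; lra.
Qed.

(** The Sturmian word of this slope: its partial sums telescope to the integer part of i * slope. *)
Definition mechanical (i : Z) : nat :=
  Z.to_nat (Int_part (IZR (i + 1) * slope) - Int_part (IZR i * slope)).

Lemma mechanical_spec i :
  (mechanical i < 2)%nat /\
  INR (mechanical i) = IZR (Int_part (IZR (i + 1) * slope)) - IZR (Int_part (IZR i * slope)).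
Proof.
destruct (base_Int_part (IZR (i + 1) * slope)) as [H1 H2].
destruct (base_Int_part (IZR i * slope)) as [H3 H4].
unfold mechanical; rewrite plus_IZR in *; pose proof slope_bounds.
set (a := Int_part ((IZR i + 1) * slope)) in *; set (b := Int_part (IZR i * slope)) in *.
assert (Hlo : (-1 < a - b)%Z) by (apply lt_IZR; rewrite minus_IZR; lra).
assert (Hhi : (a - b < 2)%Z) by (apply lt_IZR; rewrite minus_IZR; lra).
split; [lia|].
rewrite INR_IZR_INZ, Z2Nat.id, minus_IZR by lia; reflexivity.
Qed.

(** Adding 2 keeps the parity, so the discrepancy is a difference of two fractional parts. *)
Lemma mechanical_balanced w :
  (forall i, w i = mechanical i \/ w i = (mechanical i + 2)%nat) -> balanced w.
Proof.
intros Hw.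
assert (Hpar : forall i, parity (w i) = INR (mechanical i)).
{ intros i; unfold parity; destruct (mechanical_spec i) as [H _].
  destruct (Hw i) as [-> | ->]; f_equal; destruct (mechanical i) as [|[|]]; simpl; lia. }
assert (Hs : forall i, sseq (fun k => parity (w k)) i = IZR (Int_part (IZR i * slope))).
{ intros i; symmetry; apply (sseq_unique _ (fun i => IZR (Int_part (IZR i * slope)))).
  - rewrite Rmult_0_l; now rewrite Int_part_IZR.
  - intros k; rewrite Hpar, (proj2 (mechanical_spec k)); ring. }
split.
- intros i; destruct (mechanical_spec i) as [H _]; destruct (Hw i); lia.
- intros i j; rewrite !Hs, minus_IZR.
  destruct (base_Int_part (IZR i * slope)); destruct (base_Int_part (IZR j * slope)).
  apply Rabs_le; lra.
Qed.

(** * Counting words *)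

Fixpoint all_words (n : nat) : list (list nat) :=
  match n with
  | O => nil :: nil
  | S n => flat_map (fun w => map (fun a => a :: w) (seq 0 4)) (all_words n)
  end.

Lemma all_words_complete w :
  (forall j, (j < length w)%nat -> (nth j w 0 < 4)%nat) -> In w (all_words (length w)).
Proof.
induction w as [|a w IH]; intros H; simpl length; cbn [all_words]; [now left|].
apply in_flat_map; exists w; split.
- apply IH; intros j Hj; apply (H (S j)); simpl; lia.
- apply in_map_iff; exists a; split; [reflexivity|].
  apply in_seq; specialize (H 0%nat); simpl in H; lia.
Qed.

Lemma has_card_sublist {A : Type} (dec : forall a b : A, {a = b} + {a <> b})
  (P : A -> Prop) (L : list A) :
  (forall a, P a -> In a L) -> exists c, has_card P c.
Proof.
intros H.
set (f := fun a => if excluded_middle_informative (P a) then true else false).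
exists (length (nodup dec (filter f L))), (nodup dec (filter f L)).
split; [apply NoDup_nodup|]; split; [|reflexivity].
intros a; rewrite nodup_In, filter_In; unfold f.
destruct (excluded_middle_informative (P a)) as [HP|HP]; split; try tauto.
- intros _; now split; [apply H|].
- intros [_ Hft]; discriminate.
Qed.

Fixpoint mechanical_words (k : Z) (n : nat) : list (list nat) :=
  match n with
  | O => nil :: nil
  | S n => map (cons (mechanical k)) (mechanical_words (k + 1) n)
           ++ map (cons (mechanical k + 2)%nat) (mechanical_words (k + 1) n)
  end.

Lemma mechanical_words_length n : forall k, length (mechanical_words k n) = (2 ^ n)%nat.
Proof.
induction n as [|n IH]; intros k; [reflexivity|].
simpl; rewrite length_app, !length_map, !IH; lia.
Qed.

Lemma mechanical_words_NoDup n : forall k, NoDup (mechanical_words k n).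
Proof.
induction n as [|n IH]; intros k; simpl.
- constructor; [intros []|constructor].
- apply NoDup_app.
  + apply Injective_map_NoDup; [intros u v Huv; now injection Huv|apply IH].
  + apply Injective_map_NoDup; [intros u v Huv; now injection Huv|apply IH].
  + intros w H1 H2; apply in_map_iff in H1, H2.
    destruct H1 as [u [Hu _]]; destruct H2 as [v [Hv _]].
    rewrite <- Hu in Hv; injection Hv; lia.
Qed.

Lemma mechanical_words_spec n : forall k w, In w (mechanical_words k n) ->
  length w = n /\ forall j, (j < n)%nat ->
    nth j w 0%nat = mechanical (k + Z.of_nat j) \/
    nth j w 0%nat = (mechanical (k + Z.of_nat j) + 2)%nat.
Proof.
induction n as [|n IH]; intros k w Hw; simpl in Hw.
- destruct Hw as [<-|[]]; split; [reflexivity|intros; lia].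
- apply in_app_iff in Hw.
  assert (H : exists a u, (a = mechanical k \/ a = (mechanical k + 2)%nat) /\
    w = a :: u /\ In u (mechanical_words (k + 1) n)).
  { destruct Hw as [Hw|Hw]; apply in_map_iff in Hw; destruct Hw as [u [<- Hu]];
      eexists; eexists; eauto. }
  destruct H as [a [u [Ha [-> Hu]]]]; destruct (IH _ _ Hu) as [Hl Hj].
  split; [simpl; now rewrite Hl|]; intros [|j] Hjn; cbn [nth].
  + now rewrite Z.add_0_r.
  + specialize (Hj j ltac:(lia)).
    now replace (k + Z.of_nat (S j))%Z with (k + 1 + Z.of_nat j)%Z by lia.
Qed.

Lemma mechanical_words_word_of n w :
  In w (mechanical_words 0 n) -> word_of balanced n w.
Proof.
intros Hw; destruct (mechanical_words_spec n 0 w Hw) as [Hl Hj].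
split; [exact Hl|].
(* Outside the window the word is continued by the mechanical sequence itself, with high bit 0. *)
set (y := fun i => if excluded_middle_informative (0 <= i < Z.of_nat n)%Z
  then nth (Z.to_nat i) w 0%nat else mechanical i).
exists y, 0%Z; split.
- apply mechanical_balanced; intros i; unfold y.
  destruct excluded_middle_informative as [Hi|]; [|now left].
  specialize (Hj (Z.to_nat i) ltac:(lia)); rewrite Z2Nat.id in Hj by lia; exact Hj.
- intros j Hjn; unfold y; destruct excluded_middle_informative as [|H]; [|lia].
  f_equal; lia.
Qed.

Lemma balanced_entropy : positive_entropy balanced.
Proof.
assert (H : forall n, exists c, has_card (word_of balanced n) c).
{ intros n; apply (has_card_sublist (list_eq_dec Nat.eq_dec) _ (all_words n)).
  intros w [<- [y [i [Hy Hw]]]]; apply all_words_complete; intros j Hj.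
  rewrite Hw by exact Hj; apply Hy. }
apply choice in H; destruct H as [c Hcard]; exists c; split; [exact Hcard|].
assert (Hge : forall n, 2 ^ n <= INR (c n)).
{ intros n; destruct (Hcard n) as [l [_ [Hin <-]]].
  replace 2 with (INR 2) by (simpl; ring); rewrite <- pow_INR; apply le_INR.
  rewrite <- (mechanical_words_length n 0).
  apply NoDup_incl_length; [apply mechanical_words_NoDup|].
  intros w Hw; now apply Hin, mechanical_words_word_of. }
assert (Hln : 0 < ln 2) by (rewrite <- ln_1; apply ln_increasing; lra).
apply Rbar_lt_le_trans with (Finite (ln 2)); [exact Hln|].
(* [Lim_seq] is defined and monotone for all sequences, so the bound on each term passes to it. *)
rewrite <- (Lim_seq_const (ln 2)); apply Lim_seq_le_loc; exists 0%nat; intros n _.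
assert (HS : 0 < INR (S n)) by (apply lt_0_INR; lia).
apply (Rmult_le_reg_r (INR (S n))); [exact HS|].
replace (ln (INR (c (S n))) / INR (S n) * INR (S n)) with (ln (INR (c (S n)))) by (field; lra).
rewrite Rmult_comm, <- ln_pow by lra.
apply ln_le; [apply pow_lt; lra|apply Hge].
Qed.

Theorem theoremC (X : Type) (d : X -> X -> R) (phi : R -> X -> X) :
  is_metric d -> compact_metric d -> is_flow d phi ->
  (exists x, nonwandering d phi x /\ ~ Crit phi x /\
             strongly_shadowable d phi x /\ uniformly_expansive d phi x) ->
  exists Y : X -> Prop,
    closed_in d Y /\ (forall t y, Y y -> Y (phi t y)) /\
    exists (k : nat) (Sig : (Z -> nat) -> Prop) (r : (Z -> nat) -> R)
           (H : (Z -> nat) -> R -> X),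
      subshift k Sig /\ positive_entropy Sig /\ roof Sig r /\
      conj_suspension d phi Y Sig r H.
Proof.
intros Hd Hc Hf [x [Hnw [Hcrit [Hsh Hexp]]]].
assert (Hper : ~ periodic phi x) by (intros H; apply Hcrit; now right).
destruct (aperiodic_subshift_conjugacy d phi Hd Hc Hf x balanced Hnw Hper Hsh Hexp
  balanced_subshift balanced_aperiodic) as [Y [r [H [HY [Hinv [Hr Hconj]]]]]].
exists Y; split; [exact HY|]; split; [exact Hinv|].
exists 4%nat, balanced, r, H.
split; [apply balanced_subshift|]; split; [apply balanced_entropy|]; now split.
Qed.
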